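(* Let $G$ be a connected bipartite graph with $n\geq 3$ vertices. If $G$ is isomorphic neither to $C_4$ nor to $K_{2,3}$, then $$\ell_2(G)+\textsc{br}(G)\geq n.$$
   Context: Graphs are finite and simple. For a connected graph $G=(V,E)$, $d$ denotes the shortest-path distance. For distinct vertices $x,y$, the line generated by $x$ and $y$ is $\overline{xy}^G=\{z\in V: d(x,y)=d(x,z)+d(z,y)\ \text{or}\ d(x,y)=|d(x,z)-d(z,y)|\}$. $\ell_2(G)$ denotes the number of distinct sets $\overline{xy}^G$ over all pairs of vertices $x,y$ with $d(x,y)=2$. $\textsc{br}(G)$ denotes the number of bridges (cut edges) of $G$. *)

(* Defs.v *)
From mathcomp Require Import all_boot.
From mathcomp Require Import ssrint.

Set Implicit Arguments.
Unset Strict Implicit.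
Unset Printing Implicit Defensive.

(* A finite simple graph is a symmetric irreflexive relation [e : rel V] on a  *)
(* finite type [V].                                                           *)

Section Graphs.

Variables (V : finType) (e : rel V).

Definition connected : Prop := forall x y : V, connect e x y.

Definition bipartite : Prop :=
  exists A : {set V}, forall x y : V, e x y -> (x \in A) != (y \in A).

Definition has_walk (x y : V) (k : nat) : bool :=
  [exists p : k.-tuple V, path e x p && (last x p == y)].

(* The least [k < #|V|] such that there is a walk of length [k] from [x] to   *)
(* [y]; a shortest walk is a path, so it has fewer than [#|V|] edges.  The    *)
(* value is [#|V|] when [x] and [y] are not connected.                        *)
Definition dist (x y : V) : nat := find (has_walk x y) (iota 0 #|V|).

Definition line (x y : V) : {set V} :=
  [set z | (dist x y == dist x z + dist z y)
           || (dist x y == `|dist x z - dist z y|%N)].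

Definition ell2 : nat :=
  #|[set line p.1 p.2 | p : V * V & dist p.1 p.2 == 2]|.

Definition edges : {set {set V}} :=
  [set [set p.1; p.2] | p : V * V & e p.1 p.2].

Definition del_edge (E : {set V}) : rel V :=
  [rel x y | e x y && ([set x; y] != E)].

Definition bridge (E : {set V}) : bool :=
  (E \in edges) && (n_comp e V < n_comp (del_edge E) V).

Definition br : nat := #|[set E | bridge E]|.

End Graphs.

Definition isomorphic (V W : finType) (e : rel V) (e' : rel W) : Prop :=
  exists2 f : V -> W, bijective f & forall x y, e' (f x) (f y) = e x y.

(* This is the cycle C_n only for [n >= 3]. *)
Definition cycle_graph (n : nat) : rel 'I_n :=
  [rel i j : 'I_n | (val j == i.+1 %% n) || (val i == j.+1 %% n)].

Definition complete_bipartite (m n : nat) : rel ('I_m + 'I_n)%type :=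
  [rel u v | is_inl u != is_inl v].

(* Main.v *)
Require Import Defs.
From mathcomp Require Import all_boot zify.

(* For [d x y = 2] a vertex [z] misses the line [x y] iff                      *)
(* [d x z = d y z <> 1].  Induction on the number of vertices.                 *)
(* - At a cut vertex [c] the graph splits into two isometric parts; lines from *)
(*   different parts coincide only when universal, which pays for the shared   *)
(*   vertex [c], and the lines of pairs of neighbours of [c] on opposite sides *)
(*   are new and absorb the deficit of parts isomorphic to C4 or K_{2,3}.      *)
(* - Without cut vertices, two pairs on the same line lie on a geodesic        *)
(*   y - x ... a - b, with N(y) properly inside N(x) and N(b) properly inside  *)
(*   N(a).  If this never occurs, all pairs give distinct lines, and there are *)
(*   at least n of them because a vertex with a unique vertex at distance two  *)
(*   forces K_{2,m}.  Otherwise take such a [y] of least degree: deleting [y], *)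
(*   one of its neighbours, or both, leaves an isometric subgraph with at most *)
(*   one bridge, and destroys enough lines whose generating pair is unique.    *)

Set Implicit Arguments.
Unset Strict Implicit.
Unset Printing Implicit Defensive.

(** * Distances in connected bipartite graphs *)

(** In a bipartite graph the distances from a vertex to two vertices at distance two are equal or
    differ by 2. So such a line misses exactly the vertices that are equidistant from both
    generators without being adjacent to them ([in_line]), and every question about lines becomes
    arithmetic of distances.

    Cut vertex ([glued_bound]). If [S1] and [S2] meet only in [c], then the sizes of the sides add
    up to [#|V| + 1]. Both sides are isometric, so induction gives each of them enough lines and
    bridges of the whole graph. Distances add up at [c], so at most the universal line arises on
    both sides ([lines_in_glued]), and this one loss is the extra 1. A side isomorphic to C4 or
    K_{2,3} may fall short by two. Its deficit is covered by the lines of pairs of neighbours of [c]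
    on opposite sides: these are pairwise distinct ([card_mixed_lines]), and [c] has at least two
    neighbours on such a side. A side that is a single edge supplies a bridge.

    No cut vertex ([no_cut_vertex_bound]). Lines alone suffice. On more than four vertices, two
    pairs with the same line form an [outer] configuration, whose pairs have properly nested
    neighbourhoods ([shared_line_outer]). If none exists, lines correspond to pairs at distance two,
    and a degree count gives at least [#|V|] of them ([sum_dist2_le], [exceptional_or_two]).
    Otherwise some [y] is dominated, [N y \subset N x], and has a vertex at distance 4. Folding [y]
    onto [x] shows that deleting [y] is isometric, and induction applies to the rest ([deletion]).
    The lines gained must pay for the deleted vertices and for the bridges of the rest; they come
    from pairs with incomparable neighbourhoods, which share their line with no other pair. Which
    vertices to delete depends on how many vertices have neighbourhood [{x, y}] ([far_bound]). *)

Record bcgraph (V : finType) (e : rel V) : Prop := BCGraph {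
  bcg_sym : symmetric e;
  bcg_irr : irreflexive e;
  bcg_conn : connected e;
  bcg_bip : bipartite e }.

Definition nbrs (V : finType) (e : rel V) (x : V) : {set V} := [set z | e x z].

Section Distance.

Variables (V : finType) (e : rel V).
Hypothesis G : bcgraph e.

Local Notation d := (dist e).
Local Notation N := (nbrs e).
Let e_sym := bcg_sym G.

Lemma has_walkP x y k :
  reflect (exists p, [/\ size p = k, path e x p & last x p = y])
          (has_walk e x y k).
Proof.
apply: (iffP existsP) => [[p /andP[p_path /eqP p_last]]|[p [p_size p_path p_last]]].
  by exists p; rewrite size_tuple.
have sz : size p == k by apply/eqP.
by exists (Tuple sz); rewrite /= p_path p_last eqxx.
Qed.

(* [dist] is capped at [#|V|]; connectedness ensures the cap is not reached. *)
Lemma dist_lt_walk x y : d x y < #|V| /\ has_walk e x y (d x y).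
Proof.
have [p p_path ->] := connectP (bcg_conn G x y).
case/shortenP: p_path => {}p p_path p_uniq _.
have sz : size p < #|V|.
  by have := max_card (mem (x :: p)); rewrite (card_uniqP p_uniq).
have hasw : has (has_walk e x (last x p)) (iota 0 #|V|).
  apply/hasP; exists (size p); first by rewrite mem_iota add0n sz.
  by apply/has_walkP; exists p.
have lt : d x (last x p) < #|V| by move: hasw; rewrite has_find size_iota.
by split=> //; have := nth_find 0 hasw; rewrite nth_iota ?add0n.
Qed.

Lemma dist_lt x y : d x y < #|V|.
Proof. by case: (dist_lt_walk x y). Qed.

Lemma dist_walk x y : has_walk e x y (d x y).
Proof. by case: (dist_lt_walk x y). Qed.

Lemma dist_le_walk x y k : has_walk e x y k -> d x y <= k.
Proof.
move=> kw; rewrite leqNgt; apply/negP => k_lt.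
have k_lt' : k < #|V|.
  by apply: leq_trans k_lt _; rewrite -[leqRHS](size_iota 0) find_size.
by have := before_find 0 k_lt; rewrite nth_iota // add0n kw.
Qed.

Lemma distxx x : d x x = 0.
Proof. by apply/eqP; rewrite -leqn0; apply: dist_le_walk; apply/has_walkP; exists [::]. Qed.

Lemma dist0_eq x y : d x y = 0 -> x = y.
Proof. by move=> d0; have := dist_walk x y; rewrite d0 => /has_walkP[[|v p] [] //=]. Qed.

Lemma dist_edge_le x z y : e x z -> d x y <= (d z y).+1.
Proof.
move=> xz; have /has_walkP[p [<- p_path p_last]] := dist_walk z y.
by apply: dist_le_walk; apply/has_walkP; exists (z :: p); rewrite /= xz.
Qed.

Lemma dist_pred x y k : d x y = k.+1 -> exists2 z, e x z & d z y = k.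
Proof.
move=> dk; have := dist_walk x y; rewrite dk => /has_walkP[[|z p] [] //= [psz] /andP[xz zp] plast].
have := dist_edge_le y xz; rewrite dk ltnS => k_le.
exists z => //; apply/eqP; rewrite eqn_leq k_le andbT.
by apply: dist_le_walk; apply/has_walkP; exists p.
Qed.

Lemma dist_triangle x y z : d x z <= d x y + d y z.
Proof.
move dk : (d x y) => k; elim: k x dk => [|k IHk] x dk.
  by rewrite (dist0_eq dk).
have [t xt /IHk le_tz] := dist_pred dk.
by have := dist_edge_le z xt; lia.
Qed.

Lemma dist_sym x y : d x y = d y x.
Proof.
suff le u v : d u v <= d v u by apply/eqP; rewrite eqn_leq !le.
have /has_walkP[p [<- vp plast]] := dist_walk v u.
apply: dist_le_walk; apply/has_walkP; exists (rev (belast v p)).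
rewrite size_rev size_belast; split=> //.
  by rewrite -plast rev_path (eq_path (e' := e)) // => a b; rewrite e_sym.
by case: p plast {vp} => //= a p _; rewrite rev_cons last_rcons.
Qed.

Lemma edge_neq x y : e x y -> x != y.
Proof. by move=> xy; apply/eqP => Exy; rewrite Exy bcg_irr in xy. Qed.

Lemma dist_eq0 x y : (d x y == 0) = (x == y).
Proof. by apply/eqP/eqP => [/dist0_eq//|->]; rewrite distxx. Qed.

Lemma dist_eq1 x y : (d x y == 1) = e x y.
Proof.
apply/eqP/idP => [/dist_pred[z xz /dist0_eq <-]//|xy].
have := dist_edge_le y xy; rewrite distxx.
by have := edge_neq xy; rewrite -dist_eq0; lia.
Qed.

Lemma edge_dist x y : e x y -> d x y = 1.
Proof. by rewrite -dist_eq1 => /eqP. Qed.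

(** A bipartition fixes the parity of every distance, so the ends of an edge are never equidistant
    from a vertex. *)
Lemma dist_edge x z y : e x z -> d x y = (d z y).+1 \/ d z y = (d x y).+1.
Proof.
have [A bipA] := bcg_bip G.
have parity u v : odd (d u v) = ((u \in A) != (v \in A)).
  move dk : (d u v) => k; elim: k u dk => [|k IHk] u dk.
    by rewrite (dist0_eq dk) eqxx.
  have [t ut /IHk /= ->] := dist_pred dk.
  by have := bipA _ _ ut; case: (u \in A) (t \in A) (v \in A) => [] [] [].
move=> xz; have zx : e z x by rewrite e_sym.
have := dist_edge_le y xz; have := dist_edge_le y zx.
have neq : d x y <> d z y.
  move=> E; have := congr1 odd E; rewrite !parity.
  by have := bipA _ _ xz; case: (x \in A) (z \in A) (y \in A) => [] [] [].
lia.
Qed.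

Lemma dist_edger x z y : e x z -> d y x = (d y z).+1 \/ d y z = (d y x).+1.
Proof. by rewrite !(dist_sym y); apply: dist_edge. Qed.

Lemma dist_predr x y k : d y x = k.+1 -> exists2 z, e x z & d y z = k.
Proof.
by rewrite dist_sym => /dist_pred[z xz dzy]; exists z; rewrite // dist_sym.
Qed.

Lemma dist2_mid x y : d x y = 2 -> exists2 w, e w x & e w y.
Proof.
by case/dist_pred => w xw dwy; exists w; [rewrite e_sym|rewrite -dist_eq1 dwy].
Qed.

Lemma dist2P x y w : x != y -> e w x -> e w y -> d x y = 2.
Proof.
move=> neq wx wy; have xw : e x w by rewrite e_sym.
have := dist_edge y xw; rewrite (edge_dist wy).
by have := dist_eq0 x y; rewrite (negPf neq); lia.
Qed.

Lemma dist2_cases x y z : d x y = 2 ->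
  d x z = d y z \/ d x z = d y z + 2 \/ d y z = d x z + 2.
Proof.
case/dist2_mid => w wx wy.
case: (dist_edge z wx) => E; case: (dist_edge z wy) => E'; lia.
Qed.

Lemma in_line x y z : d x y = 2 ->
  (z \in line e x y) = (d x z != d y z) || (d x z == 1).
Proof.
move=> dxy; rewrite inE dxy (dist_sym z y).
by case: (dist2_cases z dxy); lia.
Qed.

Lemma line_sym x y : d x y = 2 -> line e x y = line e y x.
Proof.
move=> dxy; apply/setP => z; rewrite !in_line ?(dist_sym y) //.
by case: (dist2_cases z dxy); lia.
Qed.

(** The first step of a geodesic from [y] to [z] can also be taken from [x]; for [z = y] there is no
    such step. *)
Lemma nbrs_dist_le x y z : N y \subset N x -> z != y -> d x z <= d y z.
Proof.
move=> /subsetP sub zy; move dk : (d y z) => k.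
case: k dk => [/dist0_eq E|k]; first by rewrite E eqxx in zy.
case/dist_pred => t yt <-; apply: dist_edge_le.
by have := sub t; rewrite !inE; apply.
Qed.

End Distance.

(** * Pairs at distance two on the same line *)

(** [K] ranges over the unions of components of the graph without [c], so this is connectedness of
    that graph, stated without forming it. *)
Definition no_cut_vertex (V : finType) (e : rel V) : Prop :=
  forall c (K : {set V}), c \notin K ->
  (forall u v, u \in K -> e u v -> v != c -> v \in K) ->
  K = set0 \/ K = [set~ c].

Section SharedLines.

Variables (V : finType) (e : rel V).
Hypothesis G : bcgraph e.

Local Notation d := (dist e).
Local Notation N := (nbrs e).
Let e_sym := bcg_sym G.

Lemma line_eqP x y a b z : d x y = 2 -> d a b = 2 -> line e x y = line e a b ->
  (d x z != d y z) || (d x z == 1) = (d a z != d b z) || (d a z == 1).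
Proof. by move=> dxy dab E; rewrite -!in_line // E. Qed.

(* The set of [z] with [d x z = d y z + 2] is attached to the rest of the     *)
(* graph only through [y], so without cut vertices it is just [y].            *)
Lemma attached_nbrs_sub x y : no_cut_vertex e -> d x y = 2 ->
  (forall u v, d x v = d y v + 2 -> e u v -> d x u <> d y u + 2 ->
     v = y /\ e x u) ->
  N y \subset N x.
Proof.
move=> nocut dxy boundary.
have Y0 : [set z | (d x z == d y z + 2) && (z != y)] = set0.
  have [|u v|//|/setP/(_ x)] := nocut y [set z | (d x z == d y z + 2) && (z != y)].
  - by rewrite inE eqxx andbF.
  - rewrite !inE => /andP[/eqP Yu /negPf u_y] uv ->; rewrite andbT.
    have [//|/eqP nYv] := eqVneq; have vu : e v u by rewrite e_sym.
    by have [/eqP] := boundary _ _ Yu vu nYv; rewrite u_y.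
  - by rewrite !inE -(dist_eq0 G) distxx dxy /=; lia.
apply/subsetP => u; rewrite !inE => yu.
have uy : e u y by rewrite e_sym.
have Yy : d x y = d y y + 2 by rewrite distxx dxy.
suff nYu : d x u <> d y u + 2 by case: (boundary _ _ Yy uy nYu).
move=> Yu; move/setP: Y0 => /(_ u).
by rewrite !inE Yu eqxx (edge_neq G uy).
Qed.

(* The geodesic order is y - x - a - b, possibly with [x = a]. *)
Section Collinear.

Variables (x y a b : V) (k : nat).
Hypotheses (dxy : d x y = 2) (dab : d a b = 2) (lineE : line e x y = line e a b).
Hypotheses (dxa : d x a = k) (dya : d y a = k + 2) (dxb : d x b = k + 2).
Hypothesis (dyb : d y b = k + 4).

Let mem z := line_eqP z dxy dab lineE.

(** Along a geodesic leaving [y], the difference [d b v - d a v] could only drop from 2 to 0. As [v]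
    is on the shared line, it would then be a common neighbour of [a] and [b], which the given
    distances exclude. *)
Lemma collinear_far_side v : d x v = d y v + 2 -> d b v = d a v + 2.
Proof.
move dk : (d y v) => m; elim: m v dk => [|m IHm] v dk dxv.
  by have Ey := dist0_eq G dk; subst v; rewrite !(dist_sym G _ y) dya dyb -addnA.
have [u vu duy] := dist_predr G dk.
have := dist_edger G x vu; have := dist_edger G a vu; have := dist_edger G b vu.
have := IHm u duy; have := mem v; have := dist2_cases G v dab; have := dist2_cases G u dxy.
have := dist_triangle G x a v; have := dist_triangle G b a v.
have := dist_triangle G y v b; rewrite (dist_sym G v b) (dist_sym G b a) dyb dab dxa.
lia.
Qed.

Lemma collinear_dist v : d x v = d y v + 2 -> d a v = d y v + k + 2.
Proof.
move=> dxv; apply/eqP; rewrite eqn_leq; apply/andP; split.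
  by have := dist_triangle G a y v; rewrite (dist_sym G a y) dya; lia.
move dk : (d a v) => m; elim: m v dk dxv => [|m IHm] v dk dxv.
  by have Ea := dist0_eq G dk; subst v; lia.
have far := collinear_far_side dxv.
have [u vu dua] := dist_predr G dk.
have := dist_edger G x vu; have := dist_edger G y vu; have := dist_edger G b vu.
have := IHm u dua; have := mem u; have := dist2_cases G u dab.
have := dist2_cases G u dxy.
have vy : d y v = 0 -> v = y by move/(dist0_eq G).
have := dist_triangle G a v y; rewrite (dist_sym G v y) (dist_sym G a y) dya.
lia.
Qed.

Lemma collinear_boundary u v :
  d x v = d y v + 2 -> e u v -> d x u <> d y u + 2 -> v = y /\ e x u.
Proof.
move=> Yv uv nYu.
have far := collinear_far_side Yv; have dav := collinear_dist Yv.
have := dist_edger G x uv; have := dist_edger G y uv; have := dist_edger G b uv.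
have := dist_edger G a uv; have := mem u.
have := dist2_cases G u dab; have := dist2_cases G u dxy.
have := dist_triangle G a x u; rewrite (dist_sym G a x) dxa => *.
have [dyv dux] : d y v = 0 /\ d x u = 1 by lia.
by split; [rewrite (dist0_eq G dyv)|rewrite -(dist_eq1 G) dux].
Qed.

Lemma collinear_nbrs_sub : no_cut_vertex e -> N y \subset N x.
Proof. by move=> nocut; apply: attached_nbrs_sub collinear_boundary. Qed.

End Collinear.

(* The path is y - a - x - b: its two pairs alternate. *)
Section InterleavedPath.

Variables (x y a b : V).
Hypotheses (dxy : d x y = 2) (dab : d a b = 2) (lineE : line e x y = line e a b).
Hypotheses (dxa : d x a = 1) (dya : d y a = 1) (dxb : d x b = 1).
Hypothesis (dyb : d y b = 3).

Let mem z := line_eqP z dxy dab lineE.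

Lemma interleaved_far_side v : d x v = d y v + 2 -> d b v = d a v + 2.
Proof.
move dk : (d y v) => m; elim: m v dk => [|m IHm] v dk dxv.
  by have Ey := dist0_eq G dk; subst v; rewrite !(dist_sym G _ y) dya dyb.
have [u vu duy] := dist_predr G dk.
have := dist_edger G x vu; have := dist_edger G a vu; have := dist_edger G b vu.
have := IHm u duy; have := mem v; have := dist2_cases G v dab.
have := dist2_cases G u dxy; have := dist_triangle G x a v; rewrite dxa.
lia.
Qed.

(** Descent towards [x]: the preceding vertex of a geodesic satisfies the same equalities, and [x]
    itself is not equidistant from [x] and [y]. *)
Lemma interleaved_outside u :
  d x u = d y u -> d x u <> 1 -> d a u = d b u -> d a u <> d x u + 1.
Proof.
move dk : (d x u) => m; elim: m u dk => [|m IHm] u dk.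
  by have Ex := dist0_eq G dk; subst u; rewrite (dist_sym G y) dxy.
move=> dyu dxu1 dabu dau; have [v uv dxv] := dist_predr G dk.
have := dist_edger G a uv; have := dist_edger G b uv; have := dist_edger G y uv.
have := IHm v dxv; have := mem v; have := dist2_cases G v dab.
have := dist2_cases G v dxy; have := dist_triangle G b x v.
have := dist_triangle G a x v.
by rewrite (dist_sym G b x) (dist_sym G a x) dxa dxb; lia.
Qed.

Lemma interleaved_boundary u v :
  d x v = d y v + 2 -> e u v -> d x u <> d y u + 2 -> v = y /\ e x u.
Proof.
move=> Yv uv nYu; have far := interleaved_far_side Yv.
have dxu : d x u = d y u /\ d x u = d y v + 1.
  have := dist_edger G x uv; have := dist_edger G y uv.
  by have := dist2_cases G u dxy; lia.
have dav : d a v = d y v + 1.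
  have := dist_triangle G a y v; have := dist_triangle G x a v.
  by rewrite (dist_sym G a y) dxa dya; lia.
have [dyv dux] : d y v = 0 /\ d x u = 1.
  have := dist_edger G a uv; have := dist_edger G b uv; have := mem u.
  by have := @interleaved_outside u; have := dist2_cases G u dab; lia.
by split; [rewrite (dist0_eq G dyv)|rewrite -(dist_eq1 G) dux].
Qed.

(** With [N y \subset N x], the shared line leaves [a] as the only neighbour of [y], so [a]
    separates [y] from [x]. *)
Lemma interleaved_cut : ~ no_cut_vertex e.
Proof.
move=> nocut; have sub := attached_nbrs_sub nocut dxy interleaved_boundary.
have Ny u : e y u -> u = a.
  move=> yu; have := subsetP sub u; rewrite !inE => /(_ yu) xu.
  have xb : e x b by rewrite -(dist_eq1 G) dxb.
  apply/esym/(dist0_eq G); have := mem u; have := dist_edge G a xu.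
  have := dist_edge G b xu; have := dist2_cases G u dab.
  have := dist_triangle G y u b; rewrite (dist_sym G u).
  by rewrite !(dist_sym G u) dxa dxb (edge_dist G xu) (edge_dist G yu) dyb; lia.
have [|u v||] := nocut a [set y].
- by rewrite inE -(dist_eq0 G) (dist_sym G) dya.
- by rewrite !inE => /eqP-> /Ny->; rewrite eqxx.
- by move/setP/(_ y); rewrite !inE eqxx.
move/setP/(_ x); rewrite !inE -!(dist_eq0 G) dxa dxy; lia.
Qed.

End InterleavedPath.

(** A further vertex adjacent to a corner of the 4-cycle x - a - y - b would be on the line of that
    corner's diagonal but not on the line of the other one. So the cycle is closed under
    adjacency. *)
Lemma crossing_diagonals x y a b : d x y = 2 -> d a b = 2 ->
  line e x y = line e a b -> d x a = 1 -> d x b = 1 -> d y a = 1 -> d y b = 1 ->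
  #|V| <= 4.
Proof.
move=> dxy dab lineE dxa dxb dya dyb; pose C := [set x; y; a; b].
suff CV : C = [set: V].
  by rewrite -cardsT -CV /C !cardsU !cards1; lia.
have mem z := line_eqP z dxy dab lineE.
have step z t : z \in C -> e z t -> t \in C.
  rewrite !inE -!orbA -!(dist_eq0 G) => Cz zt.
  have dt2 := dist2_cases G t dab; have dt1 := dist2_cases G t dxy.
  have := mem t; have := dist_edger G x zt; have := dist_edger G y zt.
  have := dist_edger G a zt; have := dist_edger G b zt.
  have [dax day] := (dist_sym G a x, dist_sym G a y).
  have [dbx dby] := (dist_sym G b x, dist_sym G b y).
  have [dyx dba] := (dist_sym G y x, dist_sym G b a).
  case/or4P: Cz => /eqP/(dist0_eq G)->;
    rewrite ?dax ?day ?dbx ?dby ?dyx ?dba ?dxa ?dxb ?dya ?dyb ?dxy ?dab distxx;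
    rewrite !(dist_sym G t); clear -dt1 dt2; lia.
have walk p : forall s, s \in C -> path e s p -> last s p \in C.
  elim: p => //= t p IHp s Cs /andP[st tp]; apply: IHp tp; exact: step st.
apply/setP => z; rewrite in_setT; have [p xp ->] := connectP (bcg_conn G x z).
by apply: (walk _ _ _ xp); rewrite !inE eqxx.
Qed.

Definition outer x y a b :=
  [/\ N y \proper N x, N b \proper N a & 4 <= d y b].

Lemma collinear_outer x y a b : no_cut_vertex e ->
  d x y = 2 -> d a b = 2 -> line e x y = line e a b ->
  d y a = d x a + 2 -> d x b = d x a + 2 -> d y b = d x a + 4 -> outer x y a b.
Proof.
move=> nocut dxy dab lineE dya dxb dyb.
have subyx : N y \subset N x.
  exact: collinear_nbrs_sub dxy dab lineE erefl dya dxb dyb nocut.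
have subba : N b \subset N a.
  by apply: (@collinear_nbrs_sub a b x y (d x a)) => //; rewrite (dist_sym G).
split; last by rewrite dyb leq_addl.
  rewrite properE subyx; apply/negP => sub.
  have bx : b != x by rewrite -(dist_eq0 G) (dist_sym G) dxb addn2.
  by have := nbrs_dist_le G sub bx; lia.
rewrite properE subba; apply/negP => sub.
have ya : y != a by rewrite -(dist_eq0 G) dya addn2.
by have := nbrs_dist_le G sub ya; rewrite !(dist_sym G _ y); lia.
Qed.

(** Since all four endpoints are on the shared line and [d x a] is the least cross distance, only
    four shapes remain: the collinear one, the interleaved path, the 4-cycle, and equal pairs. *)
Lemma shared_line_closest x y a b : no_cut_vertex e -> 4 < #|V| ->
  d x y = 2 -> d a b = 2 -> line e x y = line e a b ->
  [set x; y] != [set a; b] ->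
  d x a <= d x b -> d x a <= d y a -> d x a <= d y b -> outer x y a b.
Proof.
move=> nocut V_gt4 dxy dab lineE pair_neq le_xb le_ya le_yb.
have dba : d b a = 2 by rewrite (dist_sym G).
have dyx : d y x = 2 by rewrite (dist_sym G).
have lineE' : line e x y = line e b a by rewrite lineE line_sym.
have lineE'' : line e y x = line e a b by rewrite line_sym.
have pair_line u v : d u v = 2 -> (u \in line e u v) && (v \in line e u v).
  by move=> duv; rewrite !(in_line G _ duv) !distxx (dist_sym G v u) duv.
have /andP[La Lb] := pair_line _ _ dab; have /andP[Lx Ly] := pair_line _ _ dxy.
rewrite -lineE !(in_line G _ dxy) in La Lb.
rewrite lineE !(in_line G _ dab) !(dist_sym G a) !(dist_sym G b) in Lx Ly.
have := dist2_cases G a dxy; have := dist2_cases G b dxy.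
have := dist2_cases G x dab; have := dist2_cases G y dab.
rewrite !(dist_sym G a) !(dist_sym G b) => cy cx cb ca.
have [Ey|[Ey Ea]] : d y a = d x a + 2 \/ d y a = 1 /\ d x a = 1 by clear cy cx cb; lia.
  have [Eb|[Eb Ea]] : d x b = d x a + 2 \/ d x b = 1 /\ d x a = 1 by clear cy ca cb; lia.
    have [Ed|Ed] : d y b = d x a + 4 \/ d y b = d x a by clear cx ca; lia.
      exact: collinear_outer.
    (* The common neighbour [w] of [x] and [y] is on the line but equidistant from [a] and [b],
       hence adjacent to both; this forces [x = a] and [y = b]. *)
    have [w wx wy] := dist2_mid G dxy; have xw : e x w by rewrite e_sym.
    have := line_eqP w dxy dab lineE; rewrite (edge_dist G xw) orbT.
    have := dist_edger G a wx; have := dist_edger G a wy.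
    have := dist_edger G b wx; have := dist_edger G b wy.
    rewrite (dist_sym G a x) (dist_sym G a y) (dist_sym G b x) (dist_sym G b y).
    rewrite Ey Eb Ed => *; have dxa0 : d x a = 0 by clear cx cy ca cb; lia.
    rewrite dxa0 in Ed; move: pair_neq.
    by rewrite (dist0_eq G dxa0) (dist0_eq G Ed) eqxx.
  by case: (@interleaved_cut x y b a) => //; clear cx ca; lia.
have [Eb|[Eb _]] : d x b = d x a + 2 \/ d x b = 1 /\ d x a = 1 by clear cy ca cb; lia.
  by case: (@interleaved_cut y x a b) => //; clear cx ca; lia.
have [Ed|Ed] : d y b = 1 \/ d y b = 3 by clear cx ca; lia.
  by have := crossing_diagonals dxy dab lineE Ea Eb Ey Ed; lia.
by case: (@interleaved_cut x y a b).
Qed.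

Lemma shared_line_outer x y a b : no_cut_vertex e -> 4 < #|V| ->
  d x y = 2 -> d a b = 2 -> line e x y = line e a b ->
  [set x; y] != [set a; b] ->
  [\/ outer x y a b, outer x y b a, outer y x a b | outer y x b a].
Proof.
move=> nocut V_gt4 dxy dab lineE neq.
have dba : d b a = 2 by rewrite (dist_sym G).
have dyx : d y x = 2 by rewrite (dist_sym G).
have lineE' : line e x y = line e b a by rewrite lineE line_sym.
have lineE2 : line e y x = line e a b by rewrite line_sym.
have lineE3 : line e y x = line e b a by rewrite line_sym.
have neq' : [set x; y] != [set b; a] by rewrite [[set b; a]]setUC.
have neq2 : [set y; x] != [set a; b] by rewrite setUC.
have neq3 : [set y; x] != [set b; a] by rewrite setUC.
have [le1|/ltnW le1] := leqP (d x a) (d x b);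
  have [le2|/ltnW le2] := leqP (d y a) (d y b).
- have [le3|/ltnW le3] := leqP (d x a) (d y a).
    by constructor 1; apply: shared_line_closest => //; exact: leq_trans le2.
  by constructor 3; apply: shared_line_closest => //; exact: leq_trans le1.
- have [le3|/ltnW le3] := leqP (d x a) (d y b).
    by constructor 1; apply: shared_line_closest => //; exact: leq_trans le2.
  by constructor 4; apply: shared_line_closest => //; exact: leq_trans le1.
- have [le3|/ltnW le3] := leqP (d x b) (d y a).
    by constructor 2; apply: shared_line_closest => //; exact: leq_trans le2.
  by constructor 3; apply: shared_line_closest => //; exact: leq_trans le1.
- have [le3|/ltnW le3] := leqP (d x b) (d y b).
    by constructor 2; apply: shared_line_closest => //; exact: leq_trans le2.
  by constructor 4; apply: shared_line_closest => //; exact: leq_trans le1.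
Qed.

End SharedLines.

(** * Folding a graph onto an isometric subgraph *)

Lemma connect_homo (V W : finType) (e : rel V) (e' : rel W) (f : V -> W) :
  (forall u v, e u v -> connect e' (f u) (f v)) ->
  forall u v, connect e u v -> connect e' (f u) (f v).
Proof.
move=> homo u v /connectP[p]; elim: p u => [|w p IHp] u /=.
  by move=> _ ->; apply: connect0.
by case/andP => uw wp Ev; apply: connect_trans (homo _ _ uw) (IHp _ wp Ev).
Qed.

Lemma del_edge_sym (V : finType) (e : rel V) E :
  symmetric e -> symmetric (del_edge e E).
Proof. by move=> e_sym u v; rewrite /del_edge /= e_sym setUC. Qed.

Lemma n_comp_gt1P (V : finType) (e : rel V) : symmetric e ->
  reflect (exists u v, ~~ connect e u v) (1 < n_comp e V).
Proof.
move=> e_sym; have csym := sym_connect_sym e_sym.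
apply: (iffP idP) => [|[u [v nuv]]].
  case/card_gt1P => u [v [/andP[ru _] /andP[rv _] neq]].
  exists u, v; rewrite -root_connect // (eqP ru) (eqP rv) //.
apply/card_gt1P; exists (root e u), (root e v).
by rewrite !inE !roots_root // root_connect //.
Qed.

Lemma bridgeP (V : finType) (e : rel V) (E : {set V}) :
  symmetric e -> connected e ->
  reflect (exists s t, [/\ e s t, E = [set s; t] & ~~ connect (del_edge e E) s t])
          (bridge e E).
Proof.
move=> e_sym e_conn; have d_sym := del_edge_sym E e_sym.
have comp1 : n_comp e V <= 1.
  by rewrite leqNgt; apply/(n_comp_gt1P e_sym) => -[u [v]]; rewrite e_conn.
apply: (iffP andP) => [[/imsetP[[s t] /[!inE] /= st EE]]|[s [t [st EE nst]]]].
  move=> lt; exists s, t; split=> //; apply/negP => con.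
  have : 1 < n_comp (del_edge e E) V.
    apply: leq_trans lt; rewrite ltnS.
    rewrite -(n_comp_connect (sym_connect_sym e_sym) s).
    by apply/eq_leq/eq_n_comp_r => z; rewrite !inE e_conn.
  case/(n_comp_gt1P d_sym) => u [v /negP]; apply.
  have := e_conn u v; apply: (@connect_homo _ _ _ _ id) => {u v} u v uv.
  have [EE'|neq] := eqVneq [set u; v] E; last by apply: connect1; rewrite /del_edge /= uv.
  have : u \in [set s; t] by rewrite -EE -EE' !inE eqxx.
  have : v \in [set s; t] by rewrite -EE -EE' !inE eqxx orbT.
  have con' : connect (del_edge e E) t s by rewrite (sym_connect_sym d_sym).
  by rewrite !inE => /pred2P[]-> /pred2P[]->.
split; first by apply/imsetP; exists (s, t); rewrite ?inE.
by apply: leq_ltn_trans comp1 _; apply/(n_comp_gt1P d_sym); exists s, t.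
Qed.

Section Retract.

Variables (V : finType) (e : rel V).
Hypothesis G : bcgraph e.
Variables (S : {set V}) (x : V).
Hypothesis xS : x \in S.

Local Notation d := (dist e).
Local Notation N := (nbrs e).
Let e_sym := bcg_sym G.

Definition induced : rel {v | v \in S} := [rel a b | e (val a) (val b)].

(* Vertices outside [S] are folded onto [x]; [folds] below makes this a        *)
(* 1-Lipschitz map, whence the induced subgraph is isometric.                 *)
Definition retract (v : V) : {v | v \in S} := insubd (exist _ x xS) v.

(** These are lines of the whole graph, so those of different parts can be compared; restricting
    them to [S] can only merge some. *)
Definition lines_in : {set {set V}} :=
  [set line e p.1 p.2 | p : V * V & [&& d p.1 p.2 == 2, p.1 \in S & p.2 \in S]].

Definition bridges_in : {set {set V}} := [set E | bridge e E & E \subset S].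

Lemma retract_val a : retract (val a) = a.
Proof. exact: valKd. Qed.

Lemma val_retract v : val (retract v) = if v \in S then v else x.
Proof. by rewrite val_insubd. Qed.

Hypothesis folds :
  forall u v, u \notin S -> v \in S -> e u v -> v = x \/ e x v.

Lemma retract_edge u v : e u v ->
  retract u = retract v \/ induced (retract u) (retract v).
Proof.
move=> uv; rewrite /induced /= !val_retract; have vu : e v u by rewrite e_sym.
have eq_ret w : w = x -> retract w = retract x by move->.
case: (boolP (u \in S)) => uS; case: (boolP (v \in S)) => vS.
- by right.
- case: (folds vS uS vu) => [->|xu]; last by right; rewrite e_sym.
  by left; apply: val_inj; rewrite !val_retract (negPf vS) xS.
- case: (folds uS vS uv) => [->|]; last by right.
  by left; apply: val_inj; rewrite !val_retract (negPf uS) xS.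
by left; apply: val_inj; rewrite !val_retract (negPf uS) (negPf vS).
Qed.

Lemma induced_bcgraph : bcgraph induced.
Proof.
split.
- by move=> a b; rewrite /induced /= e_sym.
- by move=> a; rewrite /induced /= bcg_irr.
- move=> a b; rewrite -(retract_val a) -(retract_val b).
  apply: connect_homo (bcg_conn G (val a) (val b)) => u v /retract_edge[->|].
    exact: connect0.
  exact: connect1.
- have [A bipA] := bcg_bip G; exists [set a | val a \in A] => a b /bipA.
  by rewrite !inE.
Qed.

Lemma induced_dist a b : dist induced a b = d (val a) (val b).
Proof.
have GH := induced_bcgraph; apply/eqP; rewrite eqn_leq; apply/andP; split.
  rewrite -{1}(retract_val a); move dk : (d (val a) (val b)) => k.
  elim: k (val a) dk => [|k IHk] u dk.
    by rewrite (dist0_eq G dk) retract_val distxx.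
  have [v uv /IHk le_k] := dist_pred G dk.
  have [->|/(dist_edge_le GH)] := retract_edge uv; first exact: leqW.
  by move/(_ b)/leq_trans; apply; rewrite ltnS.
move dk : (dist induced a b) => k; elim: k a dk => [|k IHk] a dk.
  by rewrite (dist0_eq GH dk) distxx.
have [c ac /IHk le_k] := dist_pred GH dk.
by apply: leq_trans (dist_edge_le G _ (ac : e (val a) (val c))) _; rewrite ltnS.
Qed.

Lemma induced_line a b :
  line induced a b = [set c | val c \in line e (val a) (val b)].
Proof. by apply/setP => c; rewrite !inE !induced_dist. Qed.

Lemma ell2_induced : ell2 induced <= #|lines_in|.
Proof.
pose trace (L : {set V}) : {set {v | v \in S}} := [set c | val c \in L].
apply: leq_trans (leq_imset_card trace _); apply/subset_leq_card/subsetP => L.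
case/imsetP => -[a b] /[!inE] /=; rewrite induced_dist => dab ->.
apply/imsetP; exists (line e (val a) (val b)); last exact: induced_line.
by apply/imsetP; exists (val a, val b); rewrite // inE /= dab (valP a) (valP b).
Qed.

(** Only [x] has other vertices folded onto it, so [t] is taken to be an end of the bridge other
    than [x]. If [t] had a second neighbour [u] in [S], the vertices whose retraction is joined to
    [u] off the bridge would be closed in the graph without [t]. Having no cut vertex puts [s] among
    them, so [s] and [t] would be joined off the bridge. *)
Lemma induced_bridge E : no_cut_vertex e -> bridge induced E ->
  exists s t : {v | v \in S}, [/\ induced s t, E = [set s; t], val t != x &
    forall u, u \in S -> e (val t) u -> u = val s].
Proof.
have GH := induced_bcgraph; have symH := bcg_sym GH.
move=> nocut /(bridgeP _ symH (bcg_conn GH))[s0 [t0 [st0 EE0 con0]]].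
have [s [t [st EE con tx]]] : exists s t : {v | v \in S}, [/\ induced s t,
    E = [set s; t], ~~ connect (del_edge induced E) s t & val t != x].
  have [Ex|?] := eqVneq (val t0) x; last by exists s0, t0.
  exists t0, s0; rewrite symH setUC sym_connect_sym ?st0; last first.
    exact: del_edge_sym.
  by split=> //; rewrite -Ex; apply: (edge_neq G).
exists s, t; split=> // u uS tu; apply/eqP; apply: contraNT con => us.
pose a : {v | v \in S} := exist _ u uS.
have dsym := sym_connect_sym (del_edge_sym E symH).
have ta : connect (del_edge induced E) t a.
  apply/connect1; rewrite /del_edge /induced /= tu EE; apply: contraNneq us => /setP/(_ a).
  rewrite !inE eqxx orbT; have /negPf-> : a != t; last by rewrite orbF => /esym.
  by rewrite eq_sym; apply: (edge_neq GH).
rewrite dsym; apply: connect_trans ta _.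
pose K := [set z | (z != val t) && connect (del_edge induced E) a (retract z)].
have ret_t z : z != val t -> retract z != t.
  rewrite -(inj_eq val_inj) val_retract; by case: ifP => // _ _; rewrite eq_sym.
have [|v w|K0|KT] := nocut (val t) K.
- by rewrite inE eqxx.
- rewrite !inE => /andP[vt con_v] vw wt; rewrite wt.
  apply: connect_trans con_v _; have [->|vwH] := retract_edge vw.
    exact: connect0.
  apply: connect1; rewrite /del_edge /=; apply/andP; split=> //.
  rewrite EE; apply/negP => /eqP/setP/(_ t); rewrite !inE eqxx orbT.
  by rewrite ![t == _]eq_sym (negPf (ret_t _ vt)) (negPf (ret_t _ wt)).
- move/setP: K0 => /(_ u); rewrite !inE.
  by rewrite eq_sym (edge_neq G tu) -[u]/(val a) retract_val connect0.
have : val s \in K by rewrite KT !inE; apply: (edge_neq G).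
by rewrite inE retract_val => /andP[].
Qed.

Hypothesis glued : forall u v, u \notin S -> v \in S -> e u v -> v = x.

(** A walk avoiding the bridge retracts to such a walk. Hypothesis [glued] ensures that an edge
    leaving [S] collapses to [x] and never becomes the bridge. *)
Lemma br_induced : br induced <= #|bridges_in|.
Proof.
have GH := induced_bcgraph; have symH := bcg_sym GH.
have inj : injective (fun E : {set {v | v \in S}} => val @: E).
  exact/imset_inj/val_inj.
rewrite /br -(card_imset _ inj); apply/subset_leq_card/subsetP => F.
case/imsetP => E /[!inE] /(bridgeP _ symH (bcg_conn GH))[s [t [st EE con]]] ->.
apply/andP; split; last first.
  by apply/subsetP => u /imsetP[a _ ->]; apply: valP.
apply/(bridgeP _ e_sym (bcg_conn G)); exists (val s), (val t); split=> //.
  by rewrite EE imsetU1 imset_set1.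
apply: contra con => con; rewrite -(retract_val s) -(retract_val t).
apply: connect_homo con => u v /andP[uv neq].
have vu : e v u by rewrite e_sym.
case: (boolP (u \in S)) => uS; last first.
  have -> : retract u = retract v; last exact: connect0.
  apply: val_inj; rewrite !val_retract (negPf uS); case: ifP => // vS.
  by rewrite (glued uS vS uv).
case: (boolP (v \in S)) => vS; last first.
  have -> : retract u = retract v; last exact: connect0.
  apply: val_inj; rewrite !val_retract uS (negPf vS).
  exact: (glued vS uS vu).
apply/connect1; change (e (val (retract u)) (val (retract v)) &&
  ([set retract u; retract v] != E)); rewrite !val_retract uS vS uv.
apply: contra neq => /eqP <-; rewrite imsetU1 imset_set1 !val_retract uS vS.
exact: eqxx.
Qed.

End Retract.

(** * Graphs without cut vertices *)

(* K_{2,2} = C4 and K_{2,3}; [u] and [v] form the side of size two. *)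
Definition exceptional (V : finType) (e : rel V) : bool :=
  [exists u, exists v, [&& u != v,
    [forall a, forall b, e a b == ((a \in [set u; v]) != (b \in [set u; v]))] &
    4 <= #|V| <= 5]].

Lemma exceptionalP (V : finType) (e : rel V) :
  reflect (exists u v, [/\ u != v,
    forall a b, e a b = ((a \in [set u; v]) != (b \in [set u; v])) &
    4 <= #|V| <= 5]) (exceptional e).
Proof.
apply: (iffP existsP) => -[u].
  case/existsP=> v /and3P[uv /forallP eE V45]; exists u, v; split=> // a b.
  by have /forallP/(_ b)/eqP := eE a.
case=> v [uv eE V45]; exists u; apply/existsP; exists v; rewrite uv V45 andbT /=.
by apply/forallP => a; apply/forallP => b; rewrite eE.
Qed.

(** Its use is contrapositive: a pair at distance above two shows that a subgraph is not
    exceptional. *)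
Lemma exceptional_dist_le2 (V : finType) (e : rel V) a b :
  bcgraph e -> exceptional e -> dist e a b <= 2.
Proof.
move=> G /exceptionalP[u [v [uv eE /andP[V4 _]]]].
have [->|ab] := eqVneq a b; first by rewrite distxx.
have [|nab] := boolP (e a b); first by move/(edge_dist G) ->.
have [w wT] : exists w, w \notin [set u; v].
  apply/existsP; rewrite -negb_forall; apply: contraL V4 => /forallP sub.
  rewrite -ltnNge ltnS; apply: (@leq_trans #|[set u; v]|); last by rewrite cards2; case: eqP.
  by apply/subset_leq_card/subsetP => z _; apply: sub.
have uT : u \in [set u; v] by rewrite !inE eqxx.
move: nab; rewrite eE negbK => /eqP sab; case: (boolP (b \in [set u; v])) => bT.
  by rewrite (@dist2P _ _ G a b w) // eE ?sab bT (negPf wT).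
by rewrite (@dist2P _ _ G a b u) // eE ?sab uT (negPf bT).
Qed.

Definition bound_holds (V : finType) (e : rel V) : Prop :=
  bcgraph e -> 3 <= #|V| -> ~ exceptional e -> #|V| <= ell2 e + br e.

Section NoCutVertex.

Variables (V : finType) (e : rel V).
Hypothesis G : bcgraph e.
Hypothesis nocut : no_cut_vertex e.
Hypothesis V_gt2 : 2 < #|V|.

Local Notation d := (dist e).
Local Notation N := (nbrs e).
Let e_sym := bcg_sym G.

Definition lines : {set {set V}} :=
  [set line e p.1 p.2 | p : V * V & d p.1 p.2 == 2].

Lemma two_nbrs y : 1 < #|N y|.
Proof.
rewrite ltnNge; apply/negP => le1.
have [z zy] : exists z, z != y.
  apply/existsP; rewrite -negb_forall; apply: contraL V_gt2 => /forallP yE.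
  rewrite -leqNgt; apply: (@leq_trans #|[set y]|); last by rewrite cards1.
  by apply/subset_leq_card/subsetP => z _; rewrite inE; apply: yE.
have [a ya] : exists a, e y a.
  move dk : (d y z) => k; case: k dk => [/(dist0_eq G) E|k /(dist_pred G)[a]].
    by rewrite E eqxx in zy.
  by exists a.
have Ny u : e y u -> u = a.
  by move=> yu; apply: (card_le1_eqP le1); rewrite inE.
have [|u v|/setP/(_ y)|KE] := nocut (c := a) (K := [set y]).
- by rewrite inE eq_sym (edge_neq G ya).
- by rewrite !inE => /eqP-> /Ny ->; rewrite eqxx.
- by rewrite !inE eqxx.
have := cardsC1 a; by rewrite -KE cards1; move: V_gt2; clear; lia.
Qed.

Lemma nbr_other y w : exists2 t, e y t & t != w.
Proof.
case/card_gt1P: (two_nbrs y) => s [t]; rewrite !inE => -[ys yt st].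
have [Es|?] := eqVneq s w; last by exists s.
by exists t; rewrite // -Es eq_sym.
Qed.

(** Neighbours of [y] have degree at least two and see, besides [y], only vertices at distance two,
    that is only [x]. So [y] with its neighbours is attached to the rest through [x] alone, hence
    there is no rest and the graph is K_{2,m}. *)
Lemma exceptional_or_two y :
  #|[set x | d y x == 2]| <= 1 -> exists x, [/\ x != y, d y x = 2 &
    forall a b, e a b = ((a \in [set x; y]) != (b \in [set x; y]))].
Proof.
move=> le1; have [w yw _] := nbr_other y y.
have wy : e w y by rewrite e_sym.
have [x wx xy] := nbr_other w y.
have yx : y != x by rewrite eq_sym.
have dyx : d y x = 2 by apply: (dist2P G yx wy wx).
have only z : z != y -> d y z = 2 -> z = x.
  by move=> _ dyz; apply: (card_le1_eqP le1); rewrite inE ?dyz ?dyx.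
have Nw u v : e y u -> e u v = (v \in [set x; y]).
  move=> yu; have uy : e u y by rewrite e_sym.
  have sub t : e u t -> t \in [set x; y].
    move=> ut; rewrite !inE; have [|ty] := eqVneq t y; first by rewrite orbT.
    have yt : y != t by rewrite eq_sym.
    by rewrite (only t ty (dist2P G yt uy ut)) eqxx.
  apply/idP/idP => [/sub//|]; rewrite !inE => /pred2P[]-> //.
  by have [t ut ty] := nbr_other u y; have := sub t ut; rewrite !inE (negPf ty) orbF => /eqP <-.
exists x; split=> //.
have cover u : u != x -> u != y -> e y u.
  move=> ux uy; have [|s t|/setP/(_ y)|/setP/(_ u)] := nocut (c := x) (K := y |: N y).
  - by rewrite !inE (negPf xy) /= -(dist_eq1 G) dyx.
  - rewrite !inE => /predU1P[-> -> _|ys]; first by rewrite orbT.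
    by rewrite (Nw s t ys) !inE => /pred2P[]->; rewrite eqxx.
  - by rewrite !inE eqxx.
  - by rewrite !inE (negPf uy) ux.
have side a b : a \notin [set x; y] -> e a b = (b \in [set x; y]).
  by rewrite !inE negb_or => /andP[ax ay]; rewrite (Nw a b (cover a ax ay)) !inE.
move=> a b; case: (boolP (a \in [set x; y])) => aT; last first.
  by rewrite side //; case: (b \in _).
case: (boolP (b \in [set x; y])) => bT /=; last by rewrite e_sym side // aT.
have nxy : e x y = false by rewrite e_sym -(dist_eq1 G) dyx.
move: aT bT; rewrite !inE => /pred2P[]-> /pred2P[]->; rewrite ?bcg_irr //.
by rewrite e_sym.
Qed.

(* Handshake: each line has at most the two ordered pairs [(x, y), (y, x)].   *)
Lemma sum_dist2_le :
  (forall x y a b, d x y = 2 -> d a b = 2 -> line e x y = line e a b ->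
     [set x; y] = [set a; b]) ->
  \sum_v #|[set x | d v x == 2]| <= 2 * ell2 e.
Proof.
move=> uniq_line; pose P := [set p : V * V | d p.1 p.2 == 2].
have -> : \sum_v #|[set x | d v x == 2]| = #|P|.
  rewrite -sum1_card (eq_bigl (fun p : V * V => true && (d p.1 p.2 == 2))); last first.
    by move=> p; rewrite inE.
  rewrite -(pair_big_dep xpredT (fun v x => d v x == 2) (fun _ _ => 1)) /=.
  by apply: eq_bigr => v _; rewrite sum1_card; apply: eq_card => x; rewrite inE.
rewrite -sum1_card.
rewrite (partition_big (fun p => line e p.1 p.2) (mem lines)) /=; last first.
  by move=> p Pp; apply/imset_f; rewrite inE in Pp *.
rewrite mulnC -sum_nat_const; apply: leq_sum => L.
case/imsetP => -[x y] /[!inE] /= /eqP dxy LE.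
rewrite sum1_card; apply: (@leq_trans #|[set (x, y); (y, x)]|); last first.
  by rewrite cards2; case: eqP.
apply/subset_leq_card/subsetP => -[a b] /andP[/[!inE] /= /eqP dab /eqP ELab].
rewrite LE in ELab; have Eab := uniq_line _ _ _ _ dab dxy ELab.
have : a \in [set x; y] by rewrite -Eab !inE eqxx.
have : b \in [set x; y] by rewrite -Eab !inE eqxx orbT.
rewrite !inE !xpair_eqE => /pred2P[]Eb /pred2P[]Ea; move: dab;
  by rewrite Ea Eb ?distxx ?eqxx ?orbT.
Qed.

End NoCutVertex.

(** * Deleting dominated vertices when there is no cut vertex *)

Section Deletion.

Variables (V : finType) (e : rel V).
Hypothesis G : bcgraph e.
Hypothesis nocut : no_cut_vertex e.
Hypothesis V_gt4 : 4 < #|V|.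
Hypothesis IH : forall (W : finType) (e' : rel W), #|W| < #|V| -> bound_holds e'.

Local Notation d := (dist e).
Local Notation N := (nbrs e).
Let e_sym := bcg_sym G.
Let V_gt2 : 2 < #|V|. Proof. exact: leq_trans V_gt4. Qed.
Let card_nbrs := two_nbrs G nocut V_gt2.

(** By [shared_line_outer], a pair at distance two that shares its line with another pair has
    properly nested neighbourhoods; this condition rules that out. *)
Definition incomparable p q := ~~ (N p \proper N q) && ~~ (N q \proper N p).

Lemma incomparable_line p q a b : incomparable p q ->
  d p q = 2 -> d a b = 2 -> line e p q = line e a b -> [set p; q] = [set a; b].
Proof.
move=> /andP[npq nqp] dpq dab E; apply/eqP/negPn/negP => neq.
have := shared_line_outer G nocut V_gt4 dpq dab E neq.
by case=> -[]; rewrite ?(negPf npq) ?(negPf nqp).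
Qed.

Lemma incomparable_fresh (S : {set V}) p q : incomparable p q -> d p q = 2 -> p \notin S ->
  line e p q \in lines e :\: lines_in e S.
Proof.
move=> inc dpq pS; rewrite inE; apply/andP; split; last first.
  by apply/imsetP; exists (p, q); rewrite // inE dpq.
apply: contra pS => /imsetP[[a b]] /[!inE] /= /and3P[/eqP dab aS bS] E.
have Epq := incomparable_line inc dpq dab E.
have : p \in [set a; b] by rewrite -Epq !inE eqxx.
by rewrite !inE => /pred2P[]->.
Qed.

Lemma incomparable_lines_neq p q a b : incomparable p q ->
  d p q = 2 -> d a b = 2 -> p != a -> p != b -> line e p q != line e a b.
Proof.
move=> inc dpq dab pa pb; apply/eqP => /(incomparable_line inc dpq dab) /setP/(_ p).
by rewrite !inE eqxx (negPf pa) (negPf pb).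
Qed.

Section Fold.

Variables (S : {set V}) (x y : V).
Hypothesis xS : x \in S.
Hypothesis yS : y \notin S.
Hypothesis sub : N y \subset N x.
Hypothesis folds :
  forall u v, u \notin S -> v \in S -> e u v -> v = x \/ e x v.

(** A bridge ends in some [t] whose only other neighbour is the deleted [y]. As [y] is dominated by
    [x], such a [t] is adjacent to [x], so the bridge joins [t] to [x] and [N t] is [{x, y}]. *)
Lemma br_fold : (forall t, t \in S -> t != x -> N t \subset y |: S) ->
  br (@induced V e S) <= #|[set w in S | N w == [set x; y]]|.
Proof.
move=> near; pose h w := [set retract xS x; retract xS w].
apply: leq_trans (leq_imset_card h _); apply/subset_leq_card/subsetP => E.
rewrite inE => /(induced_bridge G xS folds nocut)[s [t [st EE tx Nt]]].
have subt : N (val t) \subset [set val s; y].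
  apply/subsetP => u tu; have := subsetP (near _ (valP t) tx) u tu.
  rewrite !inE => /predU1P[->|uS]; first by rewrite eqxx orbT.
  by rewrite (Nt u uS) ?eqxx //; rewrite inE in tu.
have Et : N (val t) = [set val s; y].
  apply/eqP; rewrite eqEcard subt; apply: leq_trans (card_nbrs _).
  by rewrite cards2; case: eqP.
have ty : e (val t) y by move/setP/(_ y): Et; rewrite !inE eqxx orbT.
have tx' : e (val t) x.
  by rewrite e_sym; have := subsetP sub (val t); rewrite !inE e_sym; apply.
have Es := Nt x xS tx'; apply/imsetP; exists (val t).
  by rewrite inE (valP t) Et Es eqxx.
have Er : retract xS x = s by apply: val_inj; rewrite val_retract xS.
by rewrite /h EE Er retract_val.
Qed.

(** Induction on the subgraph plus the fresh lines [U]. The distant pair [p], [q] certifies that the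
    subgraph has at least three vertices and is not exceptional. *)
Lemma deletion p q (U : {set {set V}}) : p \in S -> q \in S -> 2 < d p q ->
  U \subset lines e :\: lines_in e S ->
  #|V| + br (@induced V e S) <= #|S| + #|U| -> #|V| <= ell2 e.
Proof.
move=> pS qS dpq subU le_card.
have GH := induced_bcgraph G xS folds.
have distH := induced_dist G xS folds.
have cardH : #|{: {v | v \in S}}| = #|S| by rewrite card_sig.
pose p' : {v | v \in S} := exist _ p pS; pose q' : {v | v \in S} := exist _ q qS.
have dpq' : 2 < dist (@induced V e S) p' q' by rewrite distH.
have le_S : #|S| <= #|lines_in e S| + br (@induced V e S).
  apply: leq_trans (_ : ell2 (@induced V e S) + br (@induced V e S) <= _); last first.
    by rewrite leq_add2r (ell2_induced G xS folds).
  rewrite -cardH; apply: IH => //.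
  - rewrite cardH; apply: proper_card; rewrite properE subset_predT /=.
    by apply/subsetPn; exists y.
  - exact: leq_trans (ltnW (dist_lt GH p' q')).
  - by move=> exc; have := exceptional_dist_le2 p' q' GH exc; rewrite leqNgt dpq'.
have sub_lines : lines_in e S \subset lines e.
  apply/subsetP => L /imsetP[pr]; rewrite inE => /and3P[dpr _ _] ->.
  by apply/imsetP; exists pr; rewrite ?inE.
have := subset_leq_card subU; rewrite cardsD (setIidPr sub_lines).
have := subset_leq_card sub_lines; have -> : ell2 e = #|lines e| by [].
move: le_S le_card; clear; lia.
Qed.

End Fold.

(** In [outer x y a b] the vertex [y] is far; hence without far vertices no two pairs share a
    line. *)
Definition far y := [exists x, exists z, [&& x != y, N y \subset N x & 4 <= d y z]].

Lemma dist_level y z k : k <= d y z -> exists t, d y t = k.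
Proof.
move dm : (d y z) => m; elim: m z dm => [|m IHm] z dm.
  by rewrite leqn0 => /eqP->; exists z.
rewrite leq_eqVlt => /predU1P[->|]; first by exists z.
by have [t _ /IHm] := dist_predr G dm.
Qed.

Lemma folds1 y x u v : N y \subset N x ->
  u \notin ~: [set y] -> v \in ~: [set y] -> e u v -> v = x \/ e x v.
Proof.
move=> /subsetP sub; rewrite !inE negbK => /eqP-> _ yv; right.
by have := sub v; rewrite !inE; apply.
Qed.

Lemma br_delete y x : x != y -> N y \subset N x ->
  br (@induced V e (~: [set y])) <= #|[set w | N w == [set x; y]]|.
Proof.
move=> xy sub; apply: leq_trans (_ : #|[set w in ~: [set y] | N w == [set x; y]]| <= _).
  apply: br_fold => //; rewrite ?inE ?xy ?eqxx //.
    by move=> u v; apply: folds1.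
  by move=> t _ _; apply/subsetP => u _; rewrite !inE orbN.
by apply/subset_leq_card/subsetP => w; rewrite !inE => /andP[].
Qed.

Lemma delete_vertex y x p q (U : {set {set V}}) : x != y -> N y \subset N x ->
  p != y -> q != y -> 2 < d p q ->
  U \subset lines e :\: lines_in e (~: [set y]) ->
  #|[set w | N w == [set x; y]]| < #|U| -> #|V| <= ell2 e.
Proof.
move=> xy sub py qy dpq subU ltU.
apply: (@deletion (~: [set y]) x y _ _ _ p q U) => //; rewrite ?inE ?eqxx //.
  by move=> u v; apply: folds1.
have := br_delete xy sub; have := cardsC [set y]; rewrite cards1.
by move: ltU; clear; lia.
Qed.

(** * A far vertex of least degree *)

Section FarVertex.

Variables (x y z : V).
Hypotheses (xy : x != y) (sub : N y \subset N x) (dyz : d y z = 4).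
(* Minimality of the degree of [y] among far dominated vertices. *)
Hypothesis y_min : forall x', N x' \subset N y -> d y x' = 2 -> N x' = N y.

Let dyx : d y x = 2.
Proof.
have [w yw _] := nbr_other G nocut V_gt2 y y.
have yx : y != x by rewrite eq_sym.
apply: (dist2P G yx (w := w)); first by rewrite e_sym.
by rewrite e_sym; have := subsetP sub w; rewrite !inE; apply.
Qed.

Let zy : z != y. Proof. by rewrite -(dist_eq0 G) (dist_sym G) dyz. Qed.

Let nbr_neq w : e y w -> w != y.
Proof. by rewrite e_sym; apply: edge_neq. Qed.

Let nbr_z w : e y w -> 2 < d w z.
Proof. by move=> yw; have := dist_edge G z yw; rewrite dyz; clear; lia. Qed.

Let nbr_neqz w : e y w -> z != w.
Proof. by move=> yw; apply/eqP => E; have := edge_dist G yw; rewrite -E dyz. Qed.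

Let y_incomparable x' : d y x' = 2 -> ~~ (N y \proper N x') -> incomparable y x'.
Proof.
move=> dx' nprop; rewrite /incomparable nprop /=; apply/negP => prop.
by have := y_min (proper_sub prop) dx' => E; rewrite E properxx in prop.
Qed.

(** These vertices become pendant at [x] when [y] is deleted; by [br_delete] they bound the number
    of bridges of the rest. *)
Let B := [set w | N w == [set x; y]].

Let delete_twin w1 w2 : e y w1 -> w1 != w2 -> N w1 = N w2 ->
  forall U : {set {set V}}, U \subset lines e :\: lines_in e (~: [set w1]) ->
  #|[set t | N t == [set w2; w1]]| < #|U| -> #|V| <= ell2 e.
Proof.
move=> yw1 w12 twin U; apply: (@delete_vertex w1 w2 y z).
- by rewrite eq_sym.
- by rewrite twin.
- by rewrite eq_sym nbr_neq.
- exact: nbr_neqz.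
- by rewrite dyz.
Qed.

Let twin_incomparable w1 w2 : N w1 = N w2 -> incomparable w1 w2.
Proof. by move=> twin; rewrite /incomparable twin properxx. Qed.

Let far_no_folded_twins : B = set0 -> #|V| <= ell2 e.
Proof.
move=> B0; have [w yw _] := nbr_other G nocut V_gt2 y y.
have [/existsP[x' /andP[/eqP dx' nprop]]|] :=
  boolP [exists x', (d y x' == 2) && ~~ (N y \proper N x')].
  apply: (@delete_vertex y x w z [set line e y x']) => //.
  - exact: nbr_neq.
  - exact: nbr_z.
  - rewrite sub1set; apply: incomparable_fresh => //; first exact: y_incomparable.
    by rewrite !inE eqxx.
  - by rewrite -/B B0 cards0 cards1.
(* Now every vertex at distance two from [y] is adjacent to all of [N y], so the neighbours of [y]
   are twins, and one of them, [w1], is deleted instead. The fresh lines join [w1] to its twin [w2]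
   and to a vertex [u] at distance 3 from [y]. *)
rewrite negb_exists => /forallP all_prop.
have Nsub x' : d y x' = 2 -> N y \proper N x'.
  by move=> dx'; have := all_prop x'; rewrite dx' /= negbK.
case/card_gt1P: (card_nbrs y) => w1 [w2]; rewrite !inE => -[yw1 yw2 w12].
have Ncase u w' : e y w' -> e w' u -> u = y \/ d y u = 2.
  move=> yw' w'u; have [->|uy] := eqVneq u y; [by left|right].
  by rewrite eq_sym in uy; apply: (dist2P G uy) w'u; rewrite e_sym.
have twin_sub w' w'' : e y w' -> e y w'' -> N w' \subset N w''.
  move=> yw' yw''; apply/subsetP => u; rewrite !inE => w'u.
  have [->|/Nsub/proper_sub/subsetP/(_ w'')] := Ncase u w' yw' w'u.
    by rewrite e_sym.
  by rewrite !inE => /(_ yw''); rewrite e_sym.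
have twin : N w1 = N w2 by apply/eqP; rewrite eqEsubset !twin_sub.
have [t dyt] : exists t, d y t = 4 by exists z.
have [u tu dyu] := dist_predr G dyt; have [x1 ux1 dyx1] := dist_predr G dyu.
have x1w1 : e x1 w1.
  by have /proper_sub/subsetP/(_ w1) := Nsub _ dyx1; rewrite !inE; apply.
have w1u : w1 != u.
  by apply/eqP => E; have := edge_dist G yw1; rewrite E dyu.
have dw1w2 : d w1 w2 = 2 by apply: (dist2P G w12 yw1 yw2).
have dw1u : d w1 u = 2 by apply: (dist2P G w1u x1w1); rewrite e_sym.
have inc_u : incomparable w1 u.
  rewrite /incomparable !properE; apply/andP; split; apply/negP => /andP[/subsetP s _].
    have := s y; rewrite !inE !(e_sym _ y) yw1 => /(_ isT)/(edge_dist G).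
    by rewrite dyu.
  have := s t; rewrite !inE (e_sym u) tu => /(_ isT) w1t.
  by have := dist_edger G y w1t; rewrite dyt (edge_dist G yw1); case.
have neq : line e w1 u != line e w1 w2.
  apply/eqP => /(incomparable_line inc_u dw1u dw1w2)/setP/(_ u).
  rewrite !inE eqxx orbT eq_sym (negPf w1u) => /esym/eqP Eu.
  by have := edge_dist G yw2; rewrite -Eu dyu.
apply: (@delete_twin w1 w2 yw1 w12 twin [set line e w1 u; line e w1 w2]).
  rewrite subUset !sub1set; apply/andP.
  by split; apply: incomparable_fresh; rewrite ?inE ?eqxx //; apply: twin_incomparable.
rewrite cards2 neq; apply: (@leq_ltn_trans #|[set y]|); last by rewrite cards1.
(* Only [y] can become pendant: any other neighbour of [w1] has a neighbourhood properly larger than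
   [N y], hence more than two neighbours. *)
apply/subset_leq_card/subsetP => s; rewrite !inE => /eqP Ns.
have sw1 : e s w1 by move/setP/(_ w1): Ns; rewrite !inE eqxx orbT.
have w1s : e w1 s by rewrite e_sym.
have [->//|/Nsub/proper_card] := Ncase s w1 yw1 w1s.
by rewrite Ns cards2 eq_sym w12 /= => lt; have := leq_trans lt (card_nbrs y); rewrite ltnn.
Qed.

Let far_many_folded_twins : 1 < #|B| -> #|V| <= ell2 e.
Proof.
case/card_gt1P => w1 [w2]; rewrite !inE => -[/eqP Nw1 /eqP Nw2 w12].
have w1y : e w1 y by move/setP/(_ y): Nw1; rewrite !inE eqxx orbT.
have w2y : e w2 y by move/setP/(_ y): Nw2; rewrite !inE eqxx orbT.
have yw1 : e y w1 by rewrite e_sym.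
have yw2 : e y w2 by rewrite e_sym.
have twin : N w1 = N w2 by rewrite Nw1.
apply: (@delete_twin w1 w2 yw1 w12 twin [set line e w1 w2]).
  rewrite sub1set; apply: incomparable_fresh; rewrite ?inE ?eqxx //.
    exact: twin_incomparable.
  exact: (dist2P G w12 yw1 yw2).
rewrite cards1 ltnS leqn0 cards_eq0; apply/eqP/setP => t; rewrite !inE.
apply/negP => /eqP Nt.
have Ny : N y = [set w2; w1].
  have tw1 : e t w1 by move/setP/(_ w1): Nt; rewrite !inE eqxx orbT.
  have : t \in N w1 by rewrite inE e_sym.
  rewrite Nw1 !inE => /pred2P[] Et; last by rewrite -Et.
  apply/eqP; rewrite eqEcard -Nt Et sub -Et Nt cards2 eq_sym w12; exact: card_nbrs.
(* A vertex made pendant by deleting [w1] would force [N y] to be [{w1, w2}], and then [x] would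
   separate these three vertices from [z]. *)
have := nocut (c := x) (K := [set y; w1; w2]); case=> [|u v||].
- rewrite !inE (negPf xy) /= negb_or; apply/andP; split; apply/eqP => E.
    by have := edge_dist G yw1; rewrite -E dyx.
  by have := edge_dist G yw2; rewrite -E dyx.
- rewrite !inE -orbA => /or3P[]/eqP-> uv vx.
  + have : v \in N y by rewrite inE.
    by rewrite Ny !inE orbC -orbA => ->; rewrite orbT.
  + have : v \in N w1 by rewrite inE.
    by rewrite Nw1 !inE (negPf vx) => /= ->.
  + have : v \in N w2 by rewrite inE.
    by rewrite Nw2 !inE (negPf vx) => /= ->.
- by move/setP/(_ y); rewrite !inE eqxx.
move/setP/(_ z); rewrite !inE (negPf zy) (negPf (nbr_neqz yw1)) (negPf (nbr_neqz yw2)).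
by move/esym/negbFE/eqP => E; move: dyx; rewrite -E dyz.
Qed.

Let far_one_folded_twin : #|B| = 1 -> #|V| <= ell2 e.
Proof.
move=> B1; have /cards1P[w BE] : #|B| == 1 by rewrite B1.
have NB t : (N t == [set x; y]) = (t == w) by move/setP/(_ t): BE; rewrite !inE.
have Nw : N w = [set x; y] by apply/eqP; rewrite NB.
have wy : e w y by move/setP/(_ y): Nw; rewrite !inE eqxx orbT.
have yw : e y w by rewrite e_sym.
have [w1 yw1 w1w] := nbr_other G nocut V_gt2 y w.
have w1y : e w1 y by rewrite e_sym.
have w1x : e w1 x by rewrite e_sym; have := subsetP sub w1; rewrite !inE; apply.
have [x' w1x' /norP[x'x x'y]] : exists2 x', e w1 x' & ~~ ((x' == x) || (x' == y)).
  have : N w1 != [set x; y] by rewrite NB.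
  rewrite eqEsubset negb_and orbC => /orP[/subsetPn[t]|/subsetPn[t]]; rewrite !inE.
    by case/pred2P=> ->; rewrite ?w1x ?w1y.
  by exists t.
have yx' : y != x' by rewrite eq_sym.
have dyx' : d y x' = 2 by apply: (dist2P G yx' w1y w1x').
have inc' : incomparable y x'.
  apply: y_incomparable => //; apply/negP => /proper_sub/subsetP/(_ w).
  rewrite !inE e_sym => /(_ wy); rewrite e_sym => wx'.
  have : x' \in N w by rewrite inE.
  by rewrite Nw !inE (negPf x'x) (negPf x'y).
have yS (t : V) : y \notin ~: [set y; t] by rewrite !inE eqxx.
have [Exy|nExy] := eqVneq (N x) (N y).
  have neq : line e y x' != line e y x.
    apply/eqP => /(incomparable_line inc' dyx' dyx)/setP/(_ x').
    by rewrite !inE eqxx orbT (negPf x'x) (negPf x'y).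
  apply: (@delete_vertex y x w z [set line e y x'; line e y x]) => //.
  - exact: nbr_neq.
  - exact: nbr_z.
  - rewrite subUset !sub1set !incomparable_fresh ?inE ?eqxx //.
    by apply: twin_incomparable.
  - by rewrite -/B B1 cards2 neq.
(* Here [N y] is a proper part of [N x]. Both [y] and [w] are deleted; no bridge remains, and the
   two vertices are paid for by the lines of [w, v] and of [y, x']. *)
have [v xv nyv] : exists2 v, e x v & ~~ e y v.
  move: nExy; rewrite eqEsubset sub andbT => /subsetPn[v]; rewrite !inE.
  by exists v.
have wv : w != v by apply/eqP => E; rewrite -E yw in nyv.
have wx : e w x by move/setP/(_ x): Nw; rewrite !inE eqxx.
have xw : e x w by rewrite e_sym.
have dwv : d w v = 2 by apply: (dist2P G wv xw xv).
have inc_v : incomparable w v.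
  rewrite /incomparable !properE; apply/andP; split; apply/negP => /andP[s _].
    have := subsetP s y; rewrite !inE wy e_sym => /(_ isT).
    by apply/negP.
  have := card_nbrs v; rewrite ltnNge => /negP[]; rewrite -(cards1 x).
  apply/subset_leq_card/subsetP => t vt; have := subsetP s t vt; rewrite Nw !inE.
  case/orP=> // /eqP Et; rewrite Et inE e_sym in vt.
  by rewrite vt in nyv.
have neq : line e w v != line e y x'.
  apply: incomparable_lines_neq => //; first exact: nbr_neq.
  by apply/eqP => E; have := edge_dist G yw; rewrite E dyx'.
have yw_neq : y != w by rewrite eq_sym nbr_neq.
have xw_neq : x != w by rewrite (edge_neq G).
have foldsS u t : u \notin ~: [set y; w] -> t \in ~: [set y; w] -> e u t ->
    t = x \/ e x t.
  rewrite !inE negbK => /pred2P[]-> /norP[ty tw] ut.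
    by right; have := subsetP sub t; rewrite !inE; apply.
  have : t \in N w by rewrite inE.
  by rewrite Nw !inE (negPf ty) orbF => /eqP; left.
have br0 : br (@induced V e (~: [set y; w])) = 0.
  apply/eqP; rewrite -leqn0.
  apply: leq_trans (@br_fold _ x y _ sub foldsS _) _.
  - by rewrite !inE negb_or xy.
  - move=> t; rewrite !inE => /norP[ty tw] tx; apply/subsetP => u tu; rewrite !inE.
    have [//|uy] := eqVneq; rewrite /=; apply/eqP => Eu.
    have : t \in N w by rewrite -Eu inE e_sym; rewrite inE in tu.
    by rewrite Nw !inE (negPf tx) (negPf ty).
  rewrite leqn0 cards_eq0; apply/eqP/setP => t; rewrite !inE NB.
  by case: (t == w); rewrite ?orbT ?andbF.
apply: (@deletion (~: [set y; w]) x y _ _ foldsS w1 z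
          [set line e w v; line e y x']).
- by rewrite !inE negb_or xy.
- exact: yS.
- by rewrite !inE negb_or w1w nbr_neq.
- by rewrite !inE negb_or zy nbr_neqz.
- exact: nbr_z.
- rewrite subUset !sub1set; apply/andP.
  by split; apply: incomparable_fresh; rewrite ?inE ?eqxx ?orbT.
have := cardsC [set y; w]; rewrite br0 !cards2 neq yw_neq; clear; lia.
Qed.

Lemma far_bound : #|V| <= ell2 e.
Proof.
have [B0|B0] := posnP #|B|.
  by apply: far_no_folded_twins; apply/eqP; rewrite -cards_eq0 B0.
have [/far_many_folded_twins//|B1] := ltnP 1 #|B|.
by apply: far_one_folded_twin; apply/eqP; rewrite eqn_leq B1.
Qed.

End FarVertex.

Lemma no_cut_vertex_bound : ~ exceptional e -> #|V| <= ell2 e.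
Proof.
move=> nexc; have [/existsP[y0 far0]|nofar] := boolP [exists y, far y].
  case: (arg_minnP (fun y => #|N y|) far0) => y /existsP[x /existsP[z0]].
  case/and3P => xy sub dyz0 ymin; have [z dyz] := dist_level dyz0.
  apply: (far_bound xy sub dyz) => x' sub' dyx'; apply/eqP.
  (* The vertex [x'] is itself far: it is dominated by [y] and is at least as far from [z] as [y]
     is. *)
  rewrite eqEcard sub' ymin //; apply/existsP; exists y; apply/existsP; exists z.
  have yx' : y != x' by rewrite -(dist_eq0 G) dyx'.
  rewrite yx' sub' /= -dyz; apply: (nbrs_dist_le G sub').
  by apply/eqP => E; rewrite E dyx' in dyz.
have uniq_line x y a b : d x y = 2 -> d a b = 2 -> line e x y = line e a b ->
    [set x; y] = [set a; b].
  move=> dxy dab E; apply/eqP/negPn/negP => neq.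
  have no_outer p q r s : ~ outer e p q r s.
    case=> prop _ le4; case/negP: nofar; apply/existsP; exists q.
    apply/existsP; exists p; apply/existsP; exists s.
    rewrite (proper_sub prop) le4 !andbT; apply/eqP => Epq.
    by rewrite Epq properxx in prop.
  by case: (shared_line_outer G nocut V_gt4 dxy dab E neq) => /no_outer.
have := sum_dist2_le uniq_line.
suff : 2 * #|V| <= \sum_v #|[set x | d v x == 2]|.
  by move=> /leq_trans H /H; rewrite leq_pmul2l.
have [/existsP[y le1]|] := boolP [exists y, #|[set x | d y x == 2]| <= 1].
  have [x [xy dyx eE]] := exceptional_or_two G nocut V_gt2 le1.
  have V_gt5 : 5 < #|V|.
    rewrite ltnNge; apply/negP => le5; apply/nexc/exceptionalP; exists x, y; split=> //.
    by rewrite le5 ltnW.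
  have dT a b : a != b -> (a \in [set x; y]) = (b \in [set x; y]) -> d a b = 2.
    move=> ab E; have [w wE] : exists w, (w \in [set x; y]) != (a \in [set x; y]).
      have [aT|aT] := boolP (a \in [set x; y]); last first.
        by exists x; rewrite !inE eqxx.
      apply/existsP; rewrite -negb_forall; apply/negP => /forallP all_in.
      have := cardsT V; suff -> : [set: V] = [set x; y].
        by rewrite cards2 => EV; move: V_gt4; rewrite -EV; case: (x != y).
      apply/setP => w; have /eqP-> := all_in w.
      by rewrite inE.
    by apply: (dist2P G (w := w)); rewrite // eE // -E.
  pose T := [set x; y].
  (* The graph is K_{2,m} with small side [T], and [V_gt5] gives at least four vertices off [T],
     each having at least three others at distance two. *)
  apply: leq_trans (_ : \sum_v (if v \in T then 1 else 3) <= _); last first.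
    apply: leq_sum => v _; case: ifP => vT.
      apply/card_gt0P; exists (if v == x then y else x); rewrite inE; apply/eqP/dT.
        by have [->|] := eqVneq v x.
      by rewrite -/T vT; case: ifP; rewrite !inE eqxx ?orbT.
    have sub : ~: (v |: T) \subset [set x | d v x == 2].
      apply/subsetP => u; rewrite !inE negb_or => /andP[uv uT].
      apply/eqP/dT; first by rewrite eq_sym.
      by rewrite -/T vT; apply/esym/negbTE; rewrite !inE.
    apply: leq_trans (subset_leq_card sub).
    by have := cardsC (v |: T); rewrite cardsU1 vT cards2 xy; move: V_gt5; clear; lia.
  rewrite (bigID (mem T)) /= (eq_bigr (fun=> 1)) => [|v ->//].
  rewrite [X in _ + X](eq_bigr (fun=> 3)) => [|v /negPf->//].
  rewrite !sum_nat_const.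
  have cardV : #|V| = 2 + #|~: T| by rewrite -(cardsC T) cards2 xy.
  have -> : #|[predC T]| = #|~: T| by apply: eq_card => v; rewrite !inE.
  rewrite [#|T|]cards2 xy muln1 cardV; move: V_gt5; rewrite cardV.
  by clear; lia.
rewrite negb_exists => /forallP all2.
rewrite mulnC -sum_nat_const; apply: leq_sum => v _.
by rewrite ltnNge all2.
Qed.

End Deletion.

(** * Gluing at a cut vertex *)

(* [S1] and [S2] cover the graph and share only the cut vertex [c]. *)
Definition glued_at (V : finType) (e : rel V) (c : V) (S1 S2 : {set V}) : Prop :=
  [/\ S1 :|: S2 = [set: V], S1 :&: S2 = [set c] &
      forall u v, u \notin S1 -> v \notin S2 -> ~~ e u v].

Section Gluing.

Variables (V : finType) (e : rel V).
Hypothesis G : bcgraph e.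

Local Notation d := (dist e).
Local Notation N := (nbrs e).
Let e_sym := bcg_sym G.

Lemma glued_at_sym c S1 S2 : glued_at e c S1 S2 -> glued_at e c S2 S1.
Proof.
by case=> U I sep; split=> [||u v uS vS]; rewrite ?(setUC S2) ?(setIC S2) // e_sym sep.
Qed.

Section OneSide.

Variables (c : V) (S1 S2 : {set V}).
Hypothesis glue : glued_at e c S1 S2.

Lemma glued_memI u : u \in S1 -> u \in S2 -> u = c.
Proof. by case: glue => _ /setP/(_ u) I _ u1 u2; apply/set1P; rewrite -I inE u1. Qed.

Lemma glued_mem : (c \in S1) && (c \in S2).
Proof. by case: glue => _ /setP/(_ c); rewrite !inE eqxx. Qed.

Lemma glued_edge u v : u \notin S1 -> v \in S1 -> e u v -> v = c.
Proof.
move=> uS vS uv; apply: glued_memI => //; apply: contraLR uv => v2.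
by case: glue => _ _; apply.
Qed.

Lemma glued_dist u v : u \in S1 -> v \in S2 -> d u v = d u c + d c v.
Proof.
move=> u1 v2; apply/eqP; rewrite eqn_leq (dist_triangle G) /=.
move dk : (d u v) => k; elim: k u u1 dk => [|k IHk] u u1 dk.
  have E := dist0_eq G dk; rewrite -E in v2.
  by rewrite -E (glued_memI u1 v2) distxx.
have [w uw dwv] := dist_pred G dk; have wu : e w u by rewrite e_sym.
case: (boolP (w \in S1)) => w1.
  by have := IHk w w1 dwv; have := dist_edge_le G c uw; clear; lia.
by have -> := glued_edge w1 u1 wu; rewrite distxx; have := dist_edge_le G v uw;
  rewrite (glued_edge w1 u1 wu) dwv.
Qed.

(** By [glued_dist], each [z] in [S2] adds the same [d c z] to both distances, so [S2] without [c]
    is entirely on the line or entirely off it. *)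
Lemma glued_line p q z : p \in S1 -> q \in S1 -> d p q = 2 ->
  z \in S2 -> z != c -> (z \in line e p q) = (d p c != d q c).
Proof.
move=> p1 q1 dpq z2 zc; rewrite (in_line G _ dpq) (glued_dist p1 z2) (glued_dist q1 z2) eqn_add2r.
have [/= Epq|//] := eqVneq; have zc' : d c z != 0 by rewrite dist_eq0 // eq_sym.
apply/negbTE; apply/eqP => E.
have /(dist0_eq G) pc : d p c = 0 by move: E zc'; clear; lia.
have /(dist0_eq G) qc : d q c = 0 by rewrite -Epq pc distxx.
by rewrite pc qc distxx in dpq.
Qed.

Lemma glued_line_sub p q z : p \in S1 -> q \in S1 -> d p q = 2 ->
  z \in S2 -> z != c -> z \in line e p q -> S2 \subset line e p q.
Proof.
move=> p1 q1 dpq z2 zc; rewrite glued_line // => neq; apply/subsetP => t t2.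
have [->|tc] := eqVneq t c; last by rewrite glued_line.
by rewrite (in_line G _ dpq) neq.
Qed.

Lemma glued_nbrs_dist u t : u \in N c :&: S1 -> t \in N c :&: S2 -> d u t = 2.
Proof.
rewrite !inE => /andP[cu u1] /andP[ct t2]; rewrite glued_dist //.
by rewrite (dist_sym G) (edge_dist G cu) (edge_dist G ct).
Qed.

(** By [nbrs_in_mixed], such a line meets [N c] only in its two generators, which makes it
    recognisable. *)
Definition mixed_lines : {set {set V}} :=
  [set line e p.1 p.2 | p in setX (N c :&: S1) (N c :&: S2)].

Lemma nbrs_in_mixed u t z : e c u -> e c t -> d u t = 2 ->
  z \in N c -> z \in line e u t -> (z == u) || (z == t).
Proof.
move=> cu ct dut; rewrite inE => cz; rewrite (in_line G _ dut).
have [//|zu] := eqVneq z u; have [//|zt] := eqVneq z t.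
rewrite (@dist2P _ _ G u z c) ?(@dist2P _ _ G t z c) //; rewrite eq_sym //.
Qed.

Lemma card_mixed_lines : #|mixed_lines| = #|N c :&: S1| * #|N c :&: S2|.
Proof.
rewrite -cardsX card_in_imset // => -[u t] [u' t'] /setXP[/= u1 t2] /setXP[/= u1' t2'] E.
have dut := glued_nbrs_dist u1 t2; have dut' := glued_nbrs_dist u1' t2'.
move: u1 t2 u1' t2'; rewrite !inE => /andP[cu u1] /andP[ct t2] /andP[cu' u1'] /andP[ct' t2'].
have neq a b : a \in S1 -> b \in S2 -> e c a -> a != b.
  move=> a1 b2 ca; apply/eqP => Eab; rewrite -Eab in b2.
  by have := glued_memI a1 b2; apply/eqP; rewrite eq_sym (edge_neq G).
have uL : u' \in line e u t.
  by rewrite E (in_line G _ dut') distxx (dist_sym G) dut'.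
have tL : t' \in line e u t by rewrite E (in_line G _ dut') distxx dut'.
have := nbrs_in_mixed cu ct dut _ uL; rewrite inE cu' (negPf (neq _ _ u1' t2 cu')).
rewrite orbF => /(_ isT)/eqP->.
have := nbrs_in_mixed cu ct dut _ tL; rewrite inE ct' eq_sym (negPf (neq _ _ u1 t2' cu)).
by move=> /(_ isT)/eqP->.
Qed.

Lemma mixed_linesP L : L \in mixed_lines -> exists u t,
  [/\ u \in N c :&: S1, t \in N c :&: S2 & L = line e u t].
Proof. by case/imsetP => -[u t] /setXP[u1 t2] ->; exists u, t. Qed.

End OneSide.

Lemma mixed_lines_sym c S1 S2 : glued_at e c S1 S2 ->
  mixed_lines c S2 S1 = mixed_lines c S1 S2.
Proof.
move=> glue; have glue' := glued_at_sym glue.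
have sub T1 T2 : glued_at e c T1 T2 -> mixed_lines c T2 T1 \subset mixed_lines c T1 T2.
  move=> gl; apply/subsetP => L /mixed_linesP[u [t [u2 t1 ->]]].
  apply/imsetP; exists (t, u); first by apply/setXP.
  by rewrite line_sym // (dist_sym G) (glued_nbrs_dist gl).
by apply/eqP; rewrite eqEsubset !sub.
Qed.

(** A line from [S2] that meets [S1] outside [c] contains all of [S1], while a mixed line has just
    one neighbour of [c] in [S1]. *)
Lemma mixed_lines_fresh c S1 S2 : glued_at e c S1 S2 -> 1 < #|N c :&: S1| ->
  [disjoint mixed_lines c S1 S2 & lines_in e S2].
Proof.
move=> glue /card_gt1P[a [b [a1 b1 ab]]]; rewrite -setI_eq0; apply/eqP/setP => L.
rewrite in_setI in_set0; apply/negP => /andP[/mixed_linesP[u [t [u1 t2 ->]]]].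
have dut := glued_nbrs_dist glue u1 t2.
case/imsetP => -[p q] /[!inE] /= /and3P[/eqP dpq p2 q2] E.
move: u1 t2 a1 b1; rewrite !inE => /andP[cu u1] /andP[ct t2] /andP[ca a1] /andP[cb b1].
have uL : u \in line e p q by rewrite -E (in_line G _ dut) distxx (dist_sym G) dut.
have uc : u != c by rewrite eq_sym (edge_neq G).
have /subsetP sub := glued_line_sub (glued_at_sym glue) p2 q2 dpq u1 uc uL.
have eq_u s : e c s -> s \in S1 -> s = u.
  move=> cs s1; have := sub s s1; rewrite -E.
  move/(nbrs_in_mixed cu ct dut); rewrite inE cs => /(_ isT)/orP[/eqP//|/eqP Est].
  rewrite Est in s1; have := glued_memI glue s1 t2 => Etc.
  by rewrite Etc bcg_irr in ct.
by rewrite (eq_u a ca a1) (eq_u b cb b1) eqxx in ab.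
Qed.

(** A line generated on both sides contains, on each side, a generator other than [c]; so it
    contains both sides and is universal. *)
Lemma lines_in_glued c S1 S2 : glued_at e c S1 S2 ->
  #|lines_in e S1 :&: lines_in e S2| <= 1.
Proof.
move=> glue; rewrite -(cards1 [set: V]); apply/subset_leq_card/subsetP => L.
rewrite in_setI !inE => /andP[/imsetP[[p q]] /[!inE] /= /and3P[/eqP dpq p1 q1] LE].
case/imsetP => -[p' q'] /[!inE] /= /and3P[/eqP dpq' p2 q2] LE'.
have sub p0 q0 p3 q3 T1 T2 : glued_at e c T1 T2 -> p0 \in T1 -> q0 \in T1 ->
    p3 \in T2 -> q3 \in T2 -> d p0 q0 = 2 -> d p3 q3 = 2 ->
    line e p0 q0 = line e p3 q3 -> T2 \subset line e p0 q0.
  move=> gl p0T q0T p3T q3T d0 d3 E.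
  have pL : p3 \in line e p0 q0 by rewrite E (in_line G _ d3) distxx (dist_sym G) d3.
  have qL : q3 \in line e p0 q0 by rewrite E (in_line G _ d3) distxx d3.
  have [Ep|pc] := eqVneq p3 c; last exact: (glued_line_sub gl p0T q0T d0 p3T pc pL).
  apply: (glued_line_sub gl p0T q0T d0 q3T _ qL).
  by apply/eqP => Eq; rewrite Ep Eq distxx in d3.
rewrite eqEsubset subsetT /=; case: (glue) => <- _ _; rewrite subUset; apply/andP; split.
  rewrite LE'; apply: (sub p' q' p q S2 S1) => //; first exact: glued_at_sym.
  by rewrite -LE' LE.
by rewrite LE; apply: (sub p q p' q' S1 S2) => //; rewrite -LE LE'.
Qed.

Lemma bridges_in_glued c S1 S2 : glued_at e c S1 S2 ->
  #|bridges_in e S1| + #|bridges_in e S2| <= br e.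
Proof.
move=> glue; rewrite -cardsUI.
have -> : bridges_in e S1 :&: bridges_in e S2 = set0.
  apply/setP => E; rewrite !inE; apply/negP => /andP[/andP[bE E1] /andP[_ E2]].
  case/(bridgeP _ e_sym (bcg_conn G)): bE => s [t [st EE _]].
  have Ec u : u \in E -> u = c.
    by move=> uE; apply: (glued_memI glue); apply: (subsetP _ _ uE).
  have sE : s \in E by rewrite EE !inE eqxx.
  have tE : t \in E by rewrite EE !inE eqxx orbT.
  by rewrite (Ec s sE) (Ec t tE) bcg_irr in st.
rewrite cards0 addn0; apply/subset_leq_card/subsetP => E.
by rewrite !inE => /orP[]/andP[].
Qed.

Lemma glued_nbr c S1 S2 z : glued_at e c S1 S2 -> z \in S1 -> z != c ->
  0 < #|N c :&: S1|.
Proof.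
move=> glue z1 zc; apply/card_gt0P; move dk : (d z c) => k.
elim: k z z1 zc dk => [|k IHk] z z1 zc dk.
  by rewrite (dist0_eq G dk) eqxx in zc.
have [t zt dtc] := dist_pred G dk; have tz : e t z by rewrite e_sym.
have [Et|tc] := eqVneq t c; first by exists z; rewrite !inE z1 -Et tz.
apply: (IHk t) => //; apply/negPn/negP => t1.
by rewrite (glued_edge glue t1 z1 tz) eqxx in zc.
Qed.

Lemma pendant_bridge c S1 S2 : glued_at e c S1 S2 -> #|S1| = 2 ->
  0 < #|bridges_in e S1|.
Proof.
move=> glue /eqP/cards2P[a [b [ab S1E]]]; have /andP[c1 c2] := glued_mem glue.
have [t tc tE] : exists2 t, t != c & S1 = [set c; t].
  move: c1; rewrite S1E !inE => /pred2P[]->; first by exists b; rewrite // eq_sym.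
  by exists a; rewrite // setUC.
have t1 : t \in S1 by rewrite tE !inE eqxx orbT.
have Nt u : e t u -> u = c.
  move=> tu; case: (boolP (u \in S1)) => u1.
    move: u1 (edge_neq G tu); rewrite tE !inE => /pred2P[]-> //.
    by rewrite eqxx.
  have ut : e u t by rewrite e_sym.
  by have Et := glued_edge glue u1 t1 ut; rewrite Et eqxx in tc.
have tce : e t c.
  have : d t c != 0 by rewrite dist_eq0.
  case dk : (d t c) => [//|k] _; have [u tu _] := dist_pred G dk.
  by rewrite -{1}(Nt u tu).
apply/card_gt0P; exists S1; rewrite inE subxx andbT.
apply/(bridgeP _ e_sym (bcg_conn G)); exists t, c; split=> //; first by rewrite tE setUC.
apply/negP => con.
have cl : closed (del_edge e S1) [set t].
  apply: intro_closed; first exact/sym_connect_sym/del_edge_sym.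
  move=> u v /andP[uv neq]; rewrite !inE => /eqP Eu; rewrite Eu in uv neq.
  by rewrite (Nt v uv) setUC -tE eqxx in neq.
by have := closed_connect cl con; rewrite !inE eqxx eq_sym (negPf tc).
Qed.

End Gluing.

(** * Counting lines and bridges across a cut vertex *)

Section GluedBound.

Variables (V : finType) (e : rel V).
Hypothesis G : bcgraph e.
Hypothesis IH : forall (W : finType) (e' : rel W), #|W| < #|V| -> bound_holds e'.

Local Notation d := (dist e).
Local Notation N := (nbrs e).
Let e_sym := bcg_sym G.

Section ExceptionalSide.

Variables (c : V) (S1 S2 : {set V}).
Hypothesis glue : glued_at e c S1 S2.
Hypothesis exc : exceptional (@induced V e S1).

Let exceptional_split : exists T : {set V}, [/\ T \subset S1, #|T| = 2,
  {in S1 &, forall a b, e a b = ((a \in T) != (b \in T))} & 4 <= #|S1| <= 5].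
Proof.
case/exceptionalP: exc => u [v [uv eE]]; rewrite card_sig => S45.
exists [set val u; val v]; split=> //.
- by apply/subsetP => w; rewrite !inE => /pred2P[]->; apply: valP.
- by rewrite cards2 (inj_eq val_inj) uv.
move=> a b aS bS; have := eE (exist _ a aS) (exist _ b bS).
by rewrite !inE -!val_eqE.
Qed.

Section Split.

Variable T : {set V}.
Hypotheses (TS : T \subset S1) (T2 : #|T| = 2) (S45 : 4 <= #|S1| <= 5).
Hypothesis eT : {in S1 &, forall a b, e a b = ((a \in T) != (b \in T))}.

Let cardO : #|S1 :\: T| = #|S1| - 2.
Proof. by rewrite cardsD (setIidPr TS) T2. Qed.

Let nbrs_side a : a \in S1 -> N a :&: S1 = if a \in T then S1 :\: T else T.
Proof.
move=> aS; have TS' := subsetP TS; apply/setP => b; rewrite !inE.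
have [bS|bS] := boolP (b \in S1).
  by rewrite eT // andbT; case: ifP => aT; rewrite ?inE ?bS ?andbT //; case: (b \in T).
by rewrite andbF; case: ifP => aT; rewrite ?inE ?(negPf bS) ?andbF //;
  apply/esym/negbTE; apply: contra bS => /TS'.
Qed.

Lemma exceptional_nbrs_gt1 a : a \in S1 -> 1 < #|N a :&: S1|.
Proof.
move=> aS; rewrite nbrs_side //; case: ifP => _; last by rewrite T2.
by rewrite cardO; move: S45; clear; lia.
Qed.

Let same_side_dist a b : a \in S1 -> b \in S1 -> a != b ->
  (a \in T) = (b \in T) -> d a b = 2.
Proof.
move=> aS bS ab E; have /ltnW/card_gt0P[w] := exceptional_nbrs_gt1 aS.
rewrite !inE => /andP[aw wS]; apply: (dist2P G (w := w)) => //; rewrite e_sym //.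
by rewrite eT // -E -eT.
Qed.

Let same_side_line p q z : p \in S1 -> q \in S1 -> d p q = 2 -> z \in S1 ->
  e p z -> z \in line e p q.
Proof. by move=> pS qS dpq zS /(edge_dist G) E; rewrite (in_line G _ dpq) E orbT. Qed.

(** If [c] is on the side of [p] and [q], then all neighbours of [c] in [S1] are adjacent to [p];
    otherwise [p] and [q] are themselves neighbours of [c]. *)
Let line_nbrs p q : p \in S1 -> q \in S1 -> d p q = 2 ->
  1 < #|N c :&: S1 :&: line e p q|.
Proof.
move=> pS qS dpq; have /andP[cS _] := glued_mem glue.
have Epq : (p \in T) = (q \in T).
  by apply/eqP/negPn; rewrite -eT // -(dist_eq1 G) dpq.
have [Ec|nEc] := eqVneq (c \in T) (p \in T).
  rewrite (setIidPl _) ?exceptional_nbrs_gt1 //; apply/subsetP => z; rewrite in_setI inE.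
  by case/andP=> cz zS; apply: same_side_line => //; rewrite eT // -Ec -eT.
have pq : p != q by rewrite -(dist_eq0 G) dpq.
apply/card_gt1P; exists p, q; split=> //; rewrite !in_setI [_ \in N c]inE (in_line G _ dpq).
  by rewrite eT // nEc pS distxx (dist_sym G q p) dpq.
by rewrite eT // -Epq nEc qS distxx dpq.
Qed.

Lemma exceptional_mixed_fresh : [disjoint mixed_lines e c S1 S2 & lines_in e S1].
Proof.
rewrite -setI_eq0; apply/eqP/setP => L; rewrite in_setI in_set0.
apply/negP => /andP[/mixed_linesP[u [t [u1 t2 ->]]]].
have dut := glued_nbrs_dist G glue u1 t2.
case/imsetP => -[p q] /[!inE] /= /and3P[/eqP dpq p1 q1] E.
move: u1 t2; rewrite !inE => /andP[cu u1] /andP[ct t2].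
have eq_u s : s \in N c :&: S1 :&: line e p q -> s = u.
  rewrite -E !in_setI => /andP[/andP[cs s1] sL].
  have /orP[/eqP//|/eqP Est] := nbrs_in_mixed G cu ct dut cs sL.
  have Etc := glued_memI glue s1; rewrite Est in Etc.
  by rewrite (Etc t2) bcg_irr in ct.
have /card_gt1P[a [b [aL bL]]] := line_nbrs p1 q1 dpq.
by rewrite (eq_u a aL) (eq_u b bL) eqxx.
Qed.

Let line_in p q : p \in S1 -> q \in S1 -> d p q = 2 -> line e p q \in lines_in e S1.
Proof. by move=> pS qS dpq; apply/imsetP; exists (p, q); rewrite // inE /= dpq pS qS. Qed.

Lemma exceptional_many_lines z : z \in S2 -> z != c -> #|S1| <= #|lines_in e S1| + 2.
Proof.
move=> z2 zc; have /andP[cS _] := glued_mem glue; have TS' := subsetP TS.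
have [S4|S5] := leqP #|S1| 4.
  have {S4}S4 : #|S1| = 4 by apply/eqP; rewrite eqn_leq S4; case/andP: S45.
  (* In C4, [A] is either diagonal pair. The two ends of [A] are equidistant from [c] exactly when
     [c] is not in [A], so [z] tells the two lines apart. *)
  have pair_line (A : {set V}) : #|A| = 2 -> A \subset S1 ->
      {in A &, forall a b, (a \in T) = (b \in T)} ->
      exists2 L, L \in lines_in e S1 & (z \in L) = (c \in A).
    move=> /eqP/cards2P[a [b [ab AE]]] AS sameA.
    have aA : a \in A by rewrite AE !inE eqxx.
    have bA : b \in A by rewrite AE !inE eqxx orbT.
    have [aS bS] := (subsetP AS _ aA, subsetP AS _ bA).
    have dab := same_side_dist aS bS ab (sameA _ _ aA bA).
    exists (line e a b); first exact: line_in.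
    rewrite (glued_line G glue aS bS dab z2 zc); have [cA|cA] := boolP (c \in A).
      move: cA; rewrite AE !inE => /pred2P[]->; rewrite distxx ?dab //.
      by rewrite (dist_sym G) dab.
    have [ca cb] : a != c /\ b != c.
      by split; apply: contraNneq cA => <-.
    have [Eca|nEca] := eqVneq (a \in T) (c \in T).
      by rewrite !same_side_dist // -?(sameA a b aA bA) // eqxx.
    have eac : e a c by rewrite eT.
    have ebc : e b c by rewrite eT // -(sameA a b aA bA).
    by rewrite (edge_dist G eac) (edge_dist G ebc).
  have [|a b aT bT|L1 L1in z1] := pair_line T T2; [exact: TS|by rewrite aT bT|].
  have [||a b|L2 L2in zL2] := pair_line (S1 :\: T).
  - by rewrite cardO S4.
  - exact: subsetDl.
  - by rewrite !inE => /andP[/negPf-> _] /andP[/negPf-> _].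
  have L12 : L1 != L2.
    by apply: contraTneq cS => E; move: zL2; rewrite -E z1 !inE; case: (c \in T) => //= <-.
  rewrite S4 (_ : 4 = 2 + 2) // leq_add2r.
  apply: (@leq_trans #|[set L1; L2]|); first by rewrite cards2 L12.
  by apply/subset_leq_card/subsetP => L; rewrite !inE => /pred2P[]->.
have {S5}S5 : #|S1| = 5 by apply/eqP; rewrite eqn_leq S5; case/andP: S45 => _ ->.
(* In K_{2,3}, the line of two vertices of the large side misses the third, so the three pairs give
   three lines. *)
have /card_gt2P[o1 [o2 [o3 [[]]]]] : 2 < #|S1 :\: T| by rewrite cardO S5.
rewrite !inE => /andP[n1 o1S] /andP[n2 o2S] /andP[n3 o3S] [o12 o23 o31].
have d12 : d o1 o2 = 2 by apply: same_side_dist; rewrite // (negPf n1) (negPf n2).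
have d23 : d o2 o3 = 2 by apply: same_side_dist; rewrite // (negPf n2) (negPf n3).
have d31 : d o3 o1 = 2 by apply: same_side_dist; rewrite // (negPf n3) (negPf n1).
have dd := (d12, d23, d31, distxx).
have s12 := dist_sym G o2 o1; have s23 := dist_sym G o3 o2; have s31 := dist_sym G o1 o3.
have l12 : line e o1 o2 != line e o2 o3.
  apply/eqP => /setP/(_ o3); rewrite !in_line // ?(s12, s23, s31) !dd //.
have l23 : line e o2 o3 != line e o3 o1.
  apply/eqP => /setP/(_ o1); rewrite !in_line // ?(s12, s23, s31) !dd //.
have l31 : line e o3 o1 != line e o1 o2.
  apply/eqP => /setP/(_ o2); rewrite !in_line // ?(s12, s23, s31) !dd //.
rewrite S5 (_ : 5 = 3 + 2) // leq_add2r.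
apply/card_gt2P; exists (line e o1 o2), (line e o2 o3), (line e o3 o1).
by split=> //; split; apply: line_in.
Qed.

End Split.

Lemma exceptional_side z : z \in S2 -> z != c ->
  [/\ [disjoint mixed_lines e c S1 S2 & lines_in e S1],
      1 < #|N c :&: S1| & #|S1| <= #|lines_in e S1| + 2].
Proof.
case: exceptional_split => T [TS T2 eT S45] z2 zc; split.
- exact: (exceptional_mixed_fresh TS T2 S45 eT).
- by apply: (exceptional_nbrs_gt1 TS T2 S45 eT); have /andP[] := glued_mem glue.
- exact: (exceptional_many_lines TS T2 S45 eT z2 zc).
Qed.

End ExceptionalSide.

Lemma ordinary_side c (S1 S2 : {set V}) : glued_at e c S1 S2 -> 2 < #|S1| < #|V| ->
  ~~ exceptional (@induced V e S1) -> #|S1| <= #|lines_in e S1| + #|bridges_in e S1|.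
Proof.
move=> glue /andP[S_gt2 ltSV] /negP nexc; have /andP[cS _] := glued_mem glue.
have folds u v : u \notin S1 -> v \in S1 -> e u v -> v = c \/ e c v.
  by move=> uS vS uv; left; exact: (glued_edge glue uS vS uv).
apply: leq_trans (_ : ell2 (@induced V e S1) + br (@induced V e S1) <= _).
  by rewrite -(card_sig (mem S1)); apply: IH => //; rewrite ?card_sig //;
     apply: (induced_bcgraph G cS folds).
apply: leq_add; first exact: (ell2_induced G cS folds).
by apply: (br_induced G cS folds) => u v; apply: (glued_edge glue).
Qed.

(** The account starts from [cardV] and loses at most 1 to a common line. Each exceptional side
    loses at most two more: one such side leaves at least two mixed lines, two such sides at least
    four. When [S2] is a single edge its bridge pays for its new vertex. *)
Lemma glued_bound c (S1 S2 : {set V}) : glued_at e c S1 S2 ->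
  S1 != [set c] -> S2 != [set c] -> 2 < #|V| -> #|V| <= ell2 e + br e.
Proof.
wlog le21 : S1 S2 / #|S2| <= #|S1|.
  move=> W glue; have [|/ltnW le] := leqP #|S2| #|S1|; first by move=> le; apply: W glue.
  by move=> n1 n2; apply: (W S2 S1) => //; apply: glued_at_sym glue.
move=> glue n1 n2 V_gt2; have glue' := glued_at_sym G glue.
have /andP[c1 c2] := glued_mem glue.
have other (S : {set V}) : c \in S -> S != [set c] -> exists2 z, z \in S & z != c.
  move=> cS nS; apply/exists_inP; apply: contraR nS => /exists_inPn all_c.
  by rewrite eqEsubset sub1set cS andbT; apply/subsetP => z /all_c; rewrite negbK inE.
have [z1 z1S z1c] := other _ c1 n1; have [z2 z2S z2c] := other _ c2 n2.
have cardV : #|V| + 1 = #|S1| + #|S2|.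
  by rewrite -cardsUI; case: glue => -> -> _; rewrite cardsT cards1.
have card2 (S : {set V}) z : c \in S -> z \in S -> z != c -> 1 < #|S|.
  by move=> cS zS zc; apply/card_gt1P; exists z, c.
have S1_gt1 := card2 _ _ c1 z1S z1c; have S2_gt1 := card2 _ _ c2 z2S z2c.
have brs := bridges_in_glued G glue.
have inter := lines_in_glued G glue.
pose M := mixed_lines e c S1 S2; pose L1 := lines_in e S1; pose L2 := lines_in e S2.
have cardM : #|M| = #|N c :&: S1| * #|N c :&: S2| := card_mixed_lines G glue.
have N1 := glued_nbr G glue z1S z1c; have N2 := glued_nbr G glue' z2S z2c.
have sub_in (S : {set V}) : lines_in e S \subset lines e.
  apply/subsetP => L /imsetP[pr]; rewrite inE => /and3P[dpr _ _] ->.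
  by apply/imsetP; exists pr; rewrite ?inE.
have subM : M \subset lines e.
  apply/subsetP => L /(mixed_linesP)[u [t [u1 t2 ->]]].
  by apply/imsetP; exists (u, t); rewrite // inE /= (glued_nbrs_dist G glue u1 t2).
have ell2E : ell2 e = #|lines e| by [].
have cardL12 : #|L1| + #|L2| <= #|L1 :|: L2| + 1 by rewrite -cardsUI leq_add2l.
have subU : L1 :|: L2 \subset lines e by rewrite subUset !sub_in.
have disjU (A B : {set {set V}}) : [disjoint A & B] -> A \subset lines e ->
    B \subset lines e -> #|A| + #|B| <= ell2 e.
  move=> dAB sA sB; rewrite ell2E -cardsUI; move: dAB; rewrite -setI_eq0 => /eqP->.
  by rewrite cards0 addn0 subset_leq_card // subUset sA.
have freshU : [disjoint M & L1] -> [disjoint M & L2] -> #|M| + #|L1 :|: L2| <= ell2 e.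
  move=> f1 f2; apply: disjU => //; move: f1 f2; rewrite -!setI_eq0 setIUr.
  by move=> /eqP-> /eqP->; rewrite setU0.
have [S2_le2|S2_gt2] := leqP #|S2| 2.
  have {S2_le2}S2E : #|S2| = 2 by apply/eqP; rewrite eqn_leq S2_le2.
  have b2 := pendant_bridge G glue' S2E.
  have [S1_le2|S1_gt2] := leqP #|S1| 2.
    have {S1_le2}S1E : #|S1| = 2 by apply/eqP; rewrite eqn_leq S1_le2.
    have b1 := pendant_bridge G glue S1E.
    have M_gt0 : 0 < #|M| by rewrite cardM muln_gt0 N1.
    have := leq_trans M_gt0 (subset_leq_card subM); rewrite -ell2E.
    by move: cardV brs b1 b2; rewrite S1E S2E; clear; lia.
  have [exc|nexc] := boolP (exceptional (@induced V e S1)).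
    have [f1 N1_gt1 le1] := exceptional_side glue exc z2S z2c.
    have M2 : 1 < #|M| by rewrite cardM (leq_trans N1_gt1) // leq_pmulr.
    have := disjU _ _ f1 subM (sub_in S1).
    by move: le1 M2 cardV brs b2; rewrite S2E -/M; clear; lia.
  have S1V : 2 < #|S1| < #|V|.
    by rewrite S1_gt2; move: cardV S2_gt1; clear; lia.
  have := ordinary_side glue S1V nexc; have := subset_leq_card (sub_in S1).
  by rewrite -ell2E; move: cardV brs b2; rewrite S2E; clear; lia.
have S1V : 2 < #|S1| < #|V|.
  by rewrite (leq_trans S2_gt2 le21); move: cardV S2_gt1; clear; lia.
have S2V : 2 < #|S2| < #|V|.
  by rewrite S2_gt2; move: cardV S1_gt1; clear; lia.
have M_sym : mixed_lines e c S2 S1 = M := mixed_lines_sym G glue.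
have [exc1|nexc1] := boolP (exceptional (@induced V e S1)).
  have [f1 N1_gt1 le1] := exceptional_side glue exc1 z2S z2c.
  have := freshU f1 (mixed_lines_fresh G glue N1_gt1).
  have [exc2|nexc2] := boolP (exceptional (@induced V e S2)).
    have [_ N2_gt1 le2] := exceptional_side glue' exc2 z1S z1c.
    have M4 : 4 <= #|M| by rewrite cardM (leq_mul N1_gt1 N2_gt1).
    by move: le1 le2 M4 cardV cardL12; rewrite -/L1 -/L2; clear; lia.
  have M2 : 1 < #|M| by rewrite cardM (leq_trans N1_gt1) // leq_pmulr.
  have := ordinary_side glue' S2V nexc2.
  by move: le1 M2 cardV cardL12 brs; rewrite -/L1 -/L2; clear; lia.
have := ordinary_side glue S1V nexc1.
have [exc2|nexc2] := boolP (exceptional (@induced V e S2)).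
  have [f2 N2_gt1 le2] := exceptional_side glue' exc2 z1S z1c.
  have := mixed_lines_fresh G glue' N2_gt1; rewrite M_sym in f2 * => f1.
  have := freshU f1 f2.
  have M2 : 1 < #|M| by rewrite cardM (leq_trans N2_gt1) // leq_pmull.
  by move: le2 M2 cardV cardL12 brs; rewrite -/L1 -/L2; clear; lia.
have := ordinary_side glue' S2V nexc2; have := subset_leq_card subU; rewrite -ell2E.
by move: cardV cardL12 brs; rewrite -/L1 -/L2; clear; lia.
Qed.

End GluedBound.

(** * The induction *)

Lemma isomorphic_trans (U V W : finType) (e1 : rel U) (e2 : rel V) (e3 : rel W) :
  isomorphic e1 e2 -> isomorphic e2 e3 -> isomorphic e1 e3.
Proof.
case=> f bf fE [g bg gE]; exists (g \o f); first exact: bij_comp.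
by move=> x y; rewrite /= gE fE.
Qed.

Lemma isomorphic_complete_bipartite (V : finType) (e : rel V) (T : {set V}) m n :
  (forall a b, e a b = ((a \in T) != (b \in T))) ->
  #|T| = m -> #|~: T| = n -> isomorphic e (@complete_bipartite m n).
Proof.
move=> eT Tm Tn.
pose g (w : 'I_m + 'I_n) : V := match w with
  | inl i => enum_val (cast_ord (esym Tm) i)
  | inr j => enum_val (cast_ord (esym Tn) j) end.
have gT w : (g w \in T) = is_inl w.
  by case: w => i /=; [exact: enum_valP|have := enum_valP (cast_ord (esym Tn) i);
    rewrite inE => /negbTE].
have g_inj : injective g.
  move=> w w' E; have := congr1 (mem T) E; rewrite /= !gT.
  by case: w w' E => i [] j //= /enum_val_inj/cast_ord_inj->.
have [|f fK gK] := inj_card_bij g_inj.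
  by rewrite card_sum !card_ord -Tm -Tn cardsC.
exists f; first by exists g.
by move=> x y; rewrite -{2}(gK x) -{2}(gK y) eT !gT.
Qed.

Lemma complete_bipartite22_cycle4 :
  isomorphic (@complete_bipartite 2 2) (@cycle_graph 4).
Proof.
pose f (w : 'I_2 + 'I_2) : 'I_4 := match w with
  | inl i => inord i.*2
  | inr j => inord j.*2.+1 end.
have fE w : val (f w) = match w with inl i => i.*2 | inr j => j.*2.+1 end.
  by case: w => -[[|[|i]] Hi] //; rewrite /= inordK.
exists f.
  apply: inj_card_bij; last by rewrite card_sum !card_ord.
  by move=> w w' /(congr1 val); rewrite !fE; case: w w' => -[[|[|i]] Hi] [] [[|[|j]] Hj] //= _;
    congr (_ _); apply: val_inj.
move=> w w'; rewrite /cycle_graph /complete_bipartite /= !fE.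
by case: w w' => -[[|[|i]] Hi] [] [[|[|j]] Hj].
Qed.

Lemma exceptional_isomorphic (V : finType) (e : rel V) : exceptional e ->
  isomorphic e (@cycle_graph 4) \/ isomorphic e (@complete_bipartite 2 3).
Proof.
case/exceptionalP => u [v [uv eT /andP[V4 V5]]].
have T2 : #|[set u; v]| = 2 by rewrite cards2 uv.
have := cardsC [set u; v]; rewrite T2 => cardV.
have [O2|O3] : #|~: [set u; v]| = 2 \/ #|~: [set u; v]| = 3.
  by move: V4 V5; rewrite -cardV; clear; lia.
- left; apply: isomorphic_trans complete_bipartite22_cycle4.
  exact: isomorphic_complete_bipartite eT T2 O2.
by right; apply: isomorphic_complete_bipartite eT T2 O3.
Qed.

Lemma cut_vertex_or_not (V : finType) (e : rel V) : symmetric e ->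
  no_cut_vertex e \/
  exists c S1 S2, [/\ glued_at e c S1 S2, S1 != [set c] & S2 != [set c]].
Proof.
move=> e_sym.
pose cuts c (K : {set V}) := [&& c \notin K, K != set0, K != [set~ c] &
  [forall u in K, forall v, e u v ==> (v != c) ==> (v \in K)]].
have [/existsP[c /existsP[K /and4P[cK K0 KT /forall_inP closedK]]]|nocut] :=
  boolP [exists c, exists K : {set V}, cuts c K].
  right; exists c, (c |: K), (~: K); split; first split.
  - by apply/setP => u; rewrite !inE; case: (u \in K); rewrite ?orbT.
  - by apply/setP => u; rewrite !inE; have [->|] := eqVneq u c; rewrite ?cK //= andbN.
  - move=> u v; rewrite !inE negbK negb_or => /andP[uc uK] vK.
    apply: contra uK => uv; have /forallP/(_ u) := closedK v vK.
    by rewrite e_sym uv uc.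
  - apply: contraNneq K0 => E; apply/eqP/setP => u; rewrite inE; apply/negP => uK.
    have : u \in [set c] by rewrite -E !inE uK orbT.
    by rewrite inE => /eqP Eu; rewrite -Eu uK in cK.
  - by apply: contraNneq KT => E; rewrite -E setCK.
left=> c K cK closedK; have [->|K0] := eqVneq K set0; [by left|right].
apply/eqP; apply: contraR nocut => KT; apply/existsP; exists c; apply/existsP; exists K.
rewrite /cuts cK K0 KT /=; apply/forall_inP => u uK; apply/forallP => v.
by apply/implyP => uv; apply/implyP; apply: closedK uv.
Qed.

(** A vertex, two neighbours and two vertices at distance two already make five, so
    [exceptional_or_two] applies. *)
Lemma small_no_cut_vertex (V : finType) (e : rel V) : bcgraph e -> no_cut_vertex e ->
  2 < #|V| <= 4 -> exceptional e.
Proof.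
move=> G nocut /andP[V_gt2 V_le4].
have /card_gt0P[y _] : 0 < #|V| by exact: leq_trans V_gt2.
have Ny := two_nbrs G nocut V_gt2 y.
have cardsD A B (C : {set V}) : A :&: B = set0 -> A :|: B \subset C ->
    #|A| + #|B| <= #|C|.
  by move=> AB sub; rewrite -cardsUI AB cards0 addn0 subset_leq_card.
have [le1|gt1] := leqP #|[set x | dist e y x == 2]| 1.
  have [x [xy dyx eT]] := exceptional_or_two G nocut V_gt2 le1.
  apply/exceptionalP; exists x, y; split=> //; rewrite (leq_trans V_le4) // andbT.
  rewrite -cardsT; apply: leq_trans (cardsD [set x; y] (nbrs e y) _ _ (subsetT _)).
    by rewrite cards2 xy (leq_add2l 2 2).
  apply/setP => u; rewrite !inE; apply/negP => /andP[/pred2P[]->].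
    by rewrite -(dist_eq1 G) dyx.
  by rewrite (bcg_irr G).
have : 4 < #|V|.
  have /leq_trans : 5 <= 1 + (#|nbrs e y| + #|[set x | dist e y x == 2]|).
    by move: Ny gt1; clear; lia.
  apply; rewrite -cardsT -[X in X + _](cards1 y).
  apply: leq_trans (cardsD [set y] [set~ y] _ _ (subsetT _)).
    rewrite leq_add2l; apply: cardsD.
      apply/setP => u; rewrite !inE -(dist_eq1 G).
      by case: eqP => //= ->.
    apply/subsetP => u; rewrite !inE -(dist_eq1 G) => /orP[]/eqP E;
      by apply/eqP => Eu; rewrite Eu distxx in E.
  by rewrite setICr.
by rewrite ltnNge V_le4.
Qed.

Lemma bcgraph_bound (V : finType) (e : rel V) : bound_holds e.
Proof.
move: {2}#|V|.+1 (ltnSn #|V|) => n; elim: n V e => // n IHn V e; rewrite ltnS => V_le.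
move=> G V_gt2 nexc.
have IH (W : finType) (e' : rel W) : #|W| < #|V| -> bound_holds e'.
  by move=> ltW; apply: IHn; apply: leq_trans V_le.
have [nocut|[c [S1 [S2 [glue n1 n2]]]]] := cut_vertex_or_not (bcg_sym G); last first.
  exact: (glued_bound G IH glue n1 n2 V_gt2).
have [V_le4|V_gt4] := leqP #|V| 4.
  by case: nexc; apply: small_no_cut_vertex; rewrite // V_gt2.
exact: leq_trans (no_cut_vertex_bound G nocut V_gt4 IH nexc) (leq_addr _ _).
Qed.

Theorem theorem3 (V : finType) (e : rel V) (e_sym : symmetric e)
    (e_irr : irreflexive e) (e_conn : connected e) (e_bip : bipartite e)
    (V_ge3 : 3 <= #|V|) (not_C4 : ~ isomorphic e (@cycle_graph 4))
    (not_K23 : ~ isomorphic e (@complete_bipartite 2 3)) :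
  #|V| <= ell2 e + br e.
Proof.
apply: bcgraph_bound => //.
by case/exceptional_isomorphic.
Qed.
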